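(* Let $n\geqslant 1$, let $A,B\in\mathbb{C}$, let $L=\sum_{0<|\alpha|\leqslant m}c_\alpha\partial^\alpha$ be a differential operator on $\mathbb{T}^n$ with constant coefficients $c_\alpha\in\mathbb{C}$ and symbol $\sigma_L$, and let $P:\mathcal{C}^\infty(\mathbb{T}^n)\to\mathcal{C}^\infty(\mathbb{T}^n)$ be the operator $Pu=Lu-Au-B\bar u$. For $\xi\in\mathbb{Z}^n$ put $$\Delta_\xi=\left(\sigma_L(\xi)-A\right)\left(\overline{\sigma_L(-\xi)}-\bar A\right)-|B|^2.$$ Then $P$ is solvable if and only if there exists $\gamma>0$ such that, for all $\xi\in\mathbb{Z}^n$, $$\|\xi\|\geqslant\gamma\ \Rightarrow\ |\Delta_\xi|\geqslant\|\xi\|^{-\gamma}.$$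
   Context: $\mathbb{T}^n\simeq\mathbb{R}^n/2\pi\mathbb{Z}^n$ is the $n$-dimensional torus, $\mathcal{C}^\infty(\mathbb{T}^n)$ is the space of smooth complex-valued functions on it, and $\|\cdot\|$ is the Euclidean norm. The sum defining $L$ runs over multi-indices $\alpha\in\mathbb{N}_0^n$ with $0<|\alpha|\leqslant m$. The symbol of $L$ is $\sigma_L(\xi)=\sum_{0<|\alpha|\leqslant m}i^{|\alpha|}c_\alpha\xi^\alpha$, $\xi\in\mathbb{Z}^n$. Solvability: the operator $P:\mathcal{C}^\infty(\mathbb{T}^n)\to\mathcal{C}^\infty(\mathbb{T}^n)$ is called solvable if there exists a subspace $\mathcal{F}\subset\mathcal{C}^\infty(\mathbb{T}^n)$ of finite codimension such that for all $f\in\mathcal{F}$ there exists $u\in\mathcal{C}^\infty(\mathbb{T}^n)$ with $Pu=f$. *)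

(* Defs.v *)
(* The analysis is done over Stdlib's R with Coquelicot's C; MathComp supplies
   the index type 'I_n and the finite sums and products over it. *)
From Stdlib Require Import Reals ZArith.
From Coquelicot Require Import Coquelicot.
From mathcomp Require Import all_boot.

Set Implicit Arguments.
Unset Strict Implicit.
Unset Printing Implicit Defensive.

Local Open Scope R_scope.

(* Coquelicot's canonical uniform structure on a function type is that of
   uniform convergence; on the finite index set 'I_n it is the max-norm
   structure, hence induces the usual topology of R^n. *)
Definition point (n : nat) := 'I_n -> R.
Definition freq (n : nat) := 'I_n -> Z.
Definition multi_index (n : nat) := 'I_n -> nat.

Definition update (n : nat) (x : point n) (j : 'I_n) (t : R) : point n :=
  fun k => if k == j then t else x k.

(* Functions on the torus R^n / 2 pi Z^n are represented by functions on R^n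
   that are 2 pi-periodic in each coordinate. *)
Definition periodic (n : nat) (u : point n -> C) : Prop :=
  forall (x : point n) (j : 'I_n), u (update x j (x j + 2 * PI)) = u x.

Definition ex_partial (n : nat) (j : 'I_n) (u : point n -> C) (x : point n) :
    Prop :=
  @ex_derive R_AbsRing C_R_NormedModule (fun t : R => u (update x j t)) (x j).

(* Coquelicot's [Derive] is only available for real-valued functions. *)
Definition partial (n : nat) (j : 'I_n) (u : point n -> C) (x : point n) : C :=
  (Derive (fun t : R => Re (u (update x j t))) (x j),
   Derive (fun t : R => Im (u (update x j t))) (x j)).

Definition iter_partial (n : nat) (s : seq 'I_n) (u : point n -> C) :
    point n -> C :=
  foldr (@partial n) u s.

Definition smooth (n : nat) (u : point n -> C) : Prop :=
  forall (s : seq 'I_n) (x : point n),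
    @continuous (fct_UniformSpace 'I_n R_UniformSpace) C_UniformSpace
      (iter_partial s u) x /\
    forall j : 'I_n, ex_partial j (iter_partial s u) x.

Definition Cinfty_torus (n : nat) (u : point n -> C) : Prop :=
  periodic u /\ smooth u.

Definition mdeg (n : nat) (alpha : multi_index n) : nat :=
  (\sum_(j < n) alpha j)%N.

(* The word of coordinates in which each j is repeated alpha j times. *)
Definition word (n : nat) (alpha : multi_index n) : seq 'I_n :=
  flatten [seq nseq (alpha j) j | j <- enum 'I_n].

Definition mpartial (n : nat) (alpha : multi_index n) (u : point n -> C) :
    point n -> C :=
  iter_partial (word alpha) u.

(* A multi-index with |alpha| <= m has all its entries at most m, so the
   finite type {ffun 'I_n -> 'I_m.+1} contains every index of the sum. *)
Definition sum_mi (n m : nat) (F : multi_index n -> C) : C :=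
  let mi (a : {ffun 'I_n -> 'I_m.+1}) : multi_index n :=
    fun j => nat_of_ord (a j) in
  \big[Cplus/RtoC 0]_(a : {ffun 'I_n -> 'I_m.+1} | (0 < mdeg (mi a) <= m)%N)
     F (mi a).

Definition diff_op (n m : nat) (c : multi_index n -> C) (u : point n -> C) :
    point n -> C :=
  fun x => sum_mi m (fun alpha => Cmult (c alpha) (mpartial alpha u x)).

Definition monomial (n : nat) (xi : freq n) (alpha : multi_index n) : R :=
  \big[Rmult/1]_(j < n) (IZR (xi j) ^ alpha j).

Definition symbol (n m : nat) (c : multi_index n -> C) (xi : freq n) : C :=
  sum_mi m (fun alpha =>
    Cmult (Cmult (Cpow Ci (mdeg alpha)) (c alpha)) (RtoC (monomial xi alpha))).

Definition vekua (n m : nat) (c : multi_index n -> C) (A B : C)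
    (u : point n -> C) : point n -> C :=
  fun x => (diff_op m c u x - A * u x - B * Cconj (u x))%C.

Definition freq_opp (n : nat) (xi : freq n) : freq n := fun j => Z.opp (xi j).

Definition vekua_disc (n m : nat) (c : multi_index n -> C) (A B : C) (xi : freq n) :
    C :=
  ((symbol m c xi - A) * (Cconj (symbol m c (freq_opp xi)) - Cconj A)
   - RtoC (pow (Cmod B) 2))%C.

Definition eucl_norm (n : nat) (xi : freq n) : R :=
  sqrt (\big[Rplus/0]_(j < n) (IZR (xi j) ^ 2)).

Record Cinfty_subspace (n : nat) (F : (point n -> C) -> Prop) : Prop := {
  subspace_incl : forall f, F f -> Cinfty_torus f;
  subspace_zero : F (fun _ => RtoC 0);
  subspace_add : forall f g, F f -> F g -> F (fun x => Cplus (f x) (g x));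
  subspace_scal : forall (a : C) f, F f -> F (fun x => Cmult a (f x))
}.

(* Finite codimension: the classes of finitely many smooth functions span the
   quotient space. *)
Definition finite_codim (n : nat) (F : (point n -> C) -> Prop) : Prop :=
  exists (k : nat) (g : 'I_k -> point n -> C),
    (forall i, Cinfty_torus (g i)) /\
    forall f, Cinfty_torus f ->
      exists a : 'I_k -> C,
        F (fun x => Cminus (f x)
             (\big[Cplus/RtoC 0]_(i < k) Cmult (a i) (g i x))).

Definition solvable (n : nat) (P : (point n -> C) -> (point n -> C)) : Prop :=
  exists F : (point n -> C) -> Prop,
    Cinfty_subspace F /\ finite_codim F /\
    forall f, F f ->
      exists u, Cinfty_torus u /\ forall x, P u x = f x.

(* Main.v *)
(* On the modes xi and -xi the equation Pu = f is a 2x2 linear system for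
   hat u(xi) and conj (hat u(-xi)), with determinant Delta_xi.

   If Delta_xi is bounded below by a negative power of |xi| for large xi, then
   for f without low modes Cramer's rule gives rapidly decreasing coefficients,
   hence a smooth u, and Pu = f because a function whose Fourier coefficients
   all vanish is zero.

   If not, some frequencies xi_k have |Delta_{xi_k}| smaller than any power of
   1/|xi_k|.  A smooth f with modes only at the xi_k, weighted by
   mu(xi_k)^(-k), is then not in the range of P, since hat u would be unbounded.
   Splitting the sequence into residue classes of k gives arbitrarily many such
   f, no nontrivial combination of which lies in the range, so no subspace of
   finite codimension does either.

   Fourier coefficients are iterated one-dimensional averages.  Translation
   invariance alone gives hat (d_j u) = i xi_j hat u, without Fubini, by
   comparing u(x + h e_j) with its Taylor expansion in h; uniqueness reduces,
   one coordinate at a time, to the one-dimensional Fejer kernel. *)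
Require Import Defs.
From Stdlib Require Import Reals ZArith Lra Lia.
From Stdlib Require Import FunctionalExtensionality Classical IndefiniteDescription.
From HB Require Import structures.
From Coquelicot Require Import Coquelicot.
From mathcomp Require Import all_boot.

Local Open Scope R_scope.

(** * Finite sums and the circle *)

(** Conjugation makes [vekua] only real-linear and ties the mode xi to -xi. In the construction of
    solutions the cutoff on low modes is therefore even in xi. In the obstruction the data must
    never contain a frequency together with its opposite: for B nonzero, a right-hand side present
    at -xi would spoil the bound of the xi-mode by Delta alone. Strict growth of the even weight
    [mu] along the chosen frequencies, with [mu] at least 2, secures this. Modes of size mu^(-k)
    face a control factor of at most mu^(-k-1), and the one spare power of [mu] is what a bounded
    hat u cannot afford.

    All averages are taken in a class of bounded periodic Lipschitz functions ([tame]). Lipschitz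
    bounds survive averaging with explicit constants, make every slice integrable, and feed the
    Fejer argument; smooth functions enter through the boundedness of their first derivatives. Real
    and imaginary parts are estimated separately, so factors 2 and 2 ^ n pile up in constants that
    only have to be finite. *)

HB.instance Definition _ := Monoid.isComLaw.Build R 0 Rplus
  (fun x y z => esym (Rplus_assoc x y z)) Rplus_comm Rplus_0_l.
HB.instance Definition _ := Monoid.isComLaw.Build R 1 Rmult
  (fun x y z => esym (Rmult_assoc x y z)) Rmult_comm Rmult_1_l.
HB.instance Definition _ := Monoid.isMulLaw.Build R 0 Rmult Rmult_0_l Rmult_0_r.
HB.instance Definition _ := Monoid.isAddLaw.Build R Rmult Rplus
  Rmult_plus_distr_r Rmult_plus_distr_l.
HB.instance Definition _ := Monoid.isComLaw.Build C (RtoC 0) Cplus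
  Cplus_assoc Cplus_comm Cplus_0_l.
HB.instance Definition _ := Monoid.isComLaw.Build C (RtoC 1) Cmult
  Cmult_assoc Cmult_comm Cmult_1_l.

Lemma Ceq (z w : C) : Re z = Re w -> Im z = Im w -> z = w.
Proof. by case: z w => [a b] [c d] /= -> ->. Qed.

Lemma sum_Rmult (I : Type) (r : seq I) (P : pred I) (F : I -> R) (a : R) :
  a * \big[Rplus/0]_(i <- r | P i) F i = \big[Rplus/0]_(i <- r | P i) (a * F i).
Proof. by apply: (big_morph (Rmult a)) => [x y|]; ring. Qed.

Lemma sum_Cmult (I : Type) (r : seq I) (P : pred I) (F : I -> C) (a : C) :
  (a * \big[Cplus/RtoC 0]_(i <- r | P i) F i
   = \big[Cplus/RtoC 0]_(i <- r | P i) (a * F i))%C.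
Proof. by apply: (big_morph (Cmult a)) => [x y|]; ring. Qed.

Lemma sum_Rle (I : Type) (r : seq I) (P : pred I) (F G : I -> R) :
  (forall i, P i -> F i <= G i) ->
  \big[Rplus/0]_(i <- r | P i) F i <= \big[Rplus/0]_(i <- r | P i) G i.
Proof. by move=> FG; apply: big_ind2 => //= *; lra. Qed.

Lemma sum_Rge0 (I : Type) (r : seq I) (P : pred I) (F : I -> R) :
  (forall i, P i -> 0 <= F i) -> 0 <= \big[Rplus/0]_(i <- r | P i) F i.
Proof. by move=> F0; apply: big_ind => //= *; lra. Qed.

Lemma sum_Rge_term (I : finType) (F : I -> R) (i : I) :
  (forall j, 0 <= F j) -> F i <= \big[Rplus/0]_j F j.
Proof.
move=> F0; rewrite (bigD1 i) //=.
have := @sum_Rge0 _ (index_enum I) (fun j => j != i) F (fun j _ => F0 j); lra.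
Qed.

Lemma sum_Rconst (I : finType) (a : R) : \big[Rplus/0]_(i : I) a = INR #|I| * a.
Proof.
rewrite big_const; elim: #|I| => [|k IH]; first by rewrite /=; ring.
by rewrite iterS IH S_INR; ring.
Qed.

Lemma prod_Rconst (n : nat) (a : R) : \big[Rmult/1]_(j < n) a = a ^ n.
Proof. by rewrite big_const card_ord; elim: n => //= k ->. Qed.

Lemma Cmod_sum (I : Type) (r : seq I) (P : pred I) (F : I -> C) :
  Cmod (\big[Cplus/RtoC 0]_(i <- r | P i) F i)
  <= \big[Rplus/0]_(i <- r | P i) Cmod (F i).
Proof.
apply: (big_ind2 (fun z a => Cmod z <= a)) => [|z a w b za wb|i _]; rewrite ?Cmod_0; try lra.
by have := Cmod_triangle z w; lra.
Qed.

Lemma Im_le_Cmod (z : C) : Rabs (Im z) <= Cmod z.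
Proof. by have := Rmax_Cmod z; have := Rmax_r (Rabs z.1) (Rabs z.2); rewrite /Im; lra. Qed.

Lemma Cmod_le_ReIm (z : C) : Cmod z <= Rabs (Re z) + Rabs (Im z).
Proof.
have -> : z = Cplus (RtoC (Re z)) (Cmult Ci (RtoC (Im z))) by apply: Ceq; rewrite /=; ring.
apply: Rle_trans (Cmod_triangle _ _) _.
by rewrite Cmod_mult Cmod_Ci !Cmod_R /=; apply: Req_le; f_equal; [f_equal|rewrite Rmult_1_l;
  f_equal]; ring.
Qed.

Lemma Rabs_sin_le (x : R) : Rabs (sin x) <= Rabs x.
Proof.
have [c [_ ]] := @MVT_gen sin 0 x cos
  (fun y _ => is_derive_sin y) (fun y _ => continuity_sin y).
rewrite sin_0 !Rminus_0_r => ->; rewrite Rabs_mult.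
have := COS_bound c; have := Rabs_pos x => ? ?.
have : Rabs (cos c) <= 1 by apply: Rabs_le; lra.
nra.
Qed.

Definition cis (t : R) : C := (cos t, sin t).

Lemma cisD (a b : R) : cis (a + b) = Cmult (cis a) (cis b).
Proof. by apply: Ceq; rewrite /= ?cos_plus ?sin_plus //; ring. Qed.

Lemma cis0 : cis 0 = RtoC 1.
Proof. by rewrite /cis cos_0 sin_0. Qed.

Lemma cisN (a : R) : cis (- a) = Cconj (cis a).
Proof. by rewrite /cis /Cconj /= cos_neg sin_neg. Qed.

Lemma Cmod_cis (a : R) : Cmod (cis a) = 1.
Proof. by rewrite /Cmod /= !Rmult_1_r Rplus_comm -/(Rsqr _) -/(Rsqr (cos a)) sin2_cos2 sqrt_1.
  Qed.

Lemma cis_2PI : cis (2 * PI) = RtoC 1.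
Proof. by rewrite /cis cos_2PI sin_2PI. Qed.

Lemma cis_period (k : Z) (t : R) : cis (t + IZR k * (2 * PI)) = cis t.
Proof.
suff H (m : nat) s : cis (s + INR m * (2 * PI)) = cis s.
  case: (Z_le_gt_dec 0 k) => hk.
    by rewrite -(Z2Nat.id k) // -INR_IZR_INZ H.
  rewrite -(H (Z.to_nat (- k)) (t + _)) INR_IZR_INZ Z2Nat.id; last lia.
  by rewrite opp_IZR; congr cis; ring.
elim: m s => [|m IH] s; first by congr cis; rewrite /=; ring.
have -> : s + INR m.+1 * (2 * PI) = (s + INR m * (2 * PI)) + 2 * PI by rewrite S_INR; ring.
by rewrite cisD cis_2PI IH Cmult_1_r.
Qed.

Lemma Rabs_cos_m1 (y : R) : Rabs (cos y - 1) <= Rabs y.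
Proof.
have -> : cos y - 1 = - (2 * sin (y / 2) * sin (y / 2)).
  by have -> : cos y = cos (2 * (y / 2)) by [congr cos; field]; rewrite cos_2a_sin; ring.
rewrite Rabs_Ropp 2!Rabs_mult (Rabs_pos_eq 2); last lra.
have := Rabs_sin_le (y / 2); have := SIN_bound (y / 2); have := Rabs_pos (sin (y / 2)).
rewrite Rabs_div; last lra. rewrite (Rabs_pos_eq 2); last lra.
move=> ? ? ?; have : Rabs (sin (y / 2)) <= 1 by apply: Rabs_le; lra.
nra.
Qed.

Lemma cis_taylor1 (y : R) : Cmod (Cminus (cis y) (RtoC 1)) <= 2 * Rabs y.
Proof.
apply: Rle_trans (Cmod_le_ReIm _) _; rewrite /=.
have := Rabs_cos_m1 y; have := Rabs_sin_le y.
by rewrite /Rminus Ropp_0 Rplus_0_r; lra.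
Qed.

(** The half-angle formula bounds the real part and the mean value theorem the imaginary part, each
    by y^2; the constant 2 is their sum. *)
Lemma cis_taylor2 (y : R) :
  Cmod (Cminus (Cminus (cis y) (RtoC 1)) (Cmult Ci (RtoC y))) <= 2 * y ^ 2.
Proof.
have Hc : Rabs (cos y - 1) <= y ^ 2.
  have -> : cos y - 1 = - (2 * (sin (y / 2)) ^ 2).
    by have -> : cos y = cos (2 * (y / 2)) by [congr cos; field]; rewrite cos_2a_sin; ring.
  rewrite Rabs_Ropp Rabs_pos_eq; last nra.
  have : (sin (y / 2)) ^ 2 <= (y / 2) ^ 2 by rewrite -!Rsqr_pow2; apply: Rsqr_le_abs_1;
    apply: Rabs_sin_le.
  nra.
have Hs : Rabs (sin y - y) <= y ^ 2.
  have [c [hc e]] := @MVT_gen (fun y => sin y - y) 0 y (fun y => cos y - 1)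
    ltac:(move=> x _; auto_derive => //; ring)
    ltac:(by move=> x _; apply: continuity_pt_minus;
      [exact: continuity_sin|exact: continuity_pt_id]).
  move: e; rewrite sin_0 !Rminus_0_r => ->.
  have -> : y ^ 2 = Rabs y * Rabs y by rewrite -Rabs_mult Rabs_pos_eq //=; nra.
  rewrite Rabs_mult; apply: Rmult_le_compat_r; first exact: Rabs_pos.
  apply: Rle_trans (Rabs_cos_m1 c) _.
  by move: hc; rewrite /Rmin /Rmax; case: Rle_dec => ? ?; rewrite /Rabs; do 2!case: Rcase_abs;
    lra.
apply: Rle_trans (Cmod_le_ReIm _) _; rewrite /=.
have -> : cos y + -(1) + -(0 * y - 1 * 0) = cos y - 1 by ring.
have -> : sin y + -0 + -(0 * 0 + 1 * y) = sin y - y by ring.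
lra.
Qed.

(** * Averages over a period *)

(** A quantitative form of continuity: an average of functions with a common Lipschitz constant is
    again Lipschitz, with no appeal to uniform continuity in a parameter. *)
Definition lip (phi : R -> C) : Prop :=
  exists K : R, forall s t, Cmod (Cminus (phi s) (phi t)) <= K * Rabs (s - t).

Lemma Rlip_continuous (f : R -> R) (K : R) :
  (forall s t, Rabs (f s - f t) <= K * Rabs (s - t)) -> forall t, continuous f t.
Proof.
move=> H t; apply/filterlim_locally => eps.
have K0 : 0 < Rabs K + 1 by have := Rabs_pos K; lra.
have d0 : 0 < eps / (Rabs K + 1) by apply: Rdiv_lt_0_compat => //; exact: cond_pos.
exists (mkposreal _ d0) => s; rewrite /ball /= /AbsRing_ball /abs /minus /plus /opp /= => hs.
have := H s t; rewrite /Rminus => Hst; apply: Rle_lt_trans Hst _.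
apply: Rle_lt_trans (_ : (Rabs K + 1) * Rabs (s + - t) < _); last first.
  by have := Rmult_lt_compat_l _ _ _ K0 hs; rewrite (_ : _ * (_ / _) = eps); [|field; lra].
by apply: Rmult_le_compat_r; [exact: Rabs_pos|have := Rle_abs K; lra].
Qed.

Lemma lip_Re (phi : R -> C) : lip phi -> forall t, continuous (fun s => Re (phi s)) t.
Proof.
move=> [K H]; apply: (@Rlip_continuous _ K) => s t.
by apply: Rle_trans (H s t); exact: (re_le_Cmod (Cminus (phi s) (phi t))).
Qed.

Lemma lip_Im (phi : R -> C) : lip phi -> forall t, continuous (fun s => Im (phi s)) t.
Proof.
move=> [K H]; apply: (@Rlip_continuous _ K) => s t.
by apply: Rle_trans (H s t); exact: (Im_le_Cmod (Cminus (phi s) (phi t))).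
Qed.

Lemma ex_RInt_cont (f : R -> R) (a b : R) : (forall t, continuous f t) -> ex_RInt f a b.
Proof. by move=> H; apply: ex_RInt_continuous => *. Qed.

Lemma lip_plus (f g : R -> C) : lip f -> lip g -> lip (fun t => Cplus (f t) (g t)).
Proof.
move=> [K H] [L H']; exists (K + L) => s t.
have -> : Cminus (Cplus (f s) (g s)) (Cplus (f t) (g t))
  = Cplus (Cminus (f s) (f t)) (Cminus (g s) (g t)) by ring.
by apply: Rle_trans (Cmod_triangle _ _) _; have := H s t; have := H' s t; lra.
Qed.

Lemma lip_scal (a : C) (f : R -> C) : lip f -> lip (fun t => Cmult a (f t)).
Proof.
move=> [K H]; exists (Cmod a * K) => s t.
have -> : Cminus (Cmult a (f s)) (Cmult a (f t)) = Cmult a (Cminus (f s) (f t)) by ring.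
by rewrite Cmod_mult Rmult_assoc; apply: Rmult_le_compat_l => //; exact: Cmod_ge_0.
Qed.

Lemma lip_mult (f g : R -> C) (M N : R) :
  (forall t, Cmod (f t) <= M) -> (forall t, Cmod (g t) <= N) ->
  lip f -> lip g -> lip (fun t => Cmult (f t) (g t)).
Proof.
move=> fM gN [K H] [L H']; exists (K * N + M * L) => s t.
have -> : Cminus (Cmult (f s) (g s)) (Cmult (f t) (g t))
  = Cplus (Cmult (Cminus (f s) (f t)) (g s)) (Cmult (f t) (Cminus (g s) (g t))) by ring.
apply: Rle_trans (Cmod_triangle _ _) _; rewrite !Cmod_mult.
have := H s t; have := H' s t; have := fM t; have := gN s.
have := Cmod_ge_0 (Cminus (f s) (f t)); have := Cmod_ge_0 (Cminus (g s) (g t)).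
have := Cmod_ge_0 (f t); have := Cmod_ge_0 (g s) => ? ? ? ? ? ? ? ?.
have h1 : Cmod (Cminus (f s) (f t)) * Cmod (g s) <= (K * Rabs (s - t)) * N.
  by apply: Rmult_le_compat.
have h2 : Cmod (f t) * Cmod (Cminus (g s) (g t)) <= M * (L * Rabs (s - t)).
  by apply: Rmult_le_compat.
lra.
Qed.

Lemma cis_lip (s t : R) : Cmod (Cminus (cis s) (cis t)) <= 2 * Rabs (s - t).
Proof.
have -> : Cminus (cis s) (cis t) = Cmult (cis t) (Cminus (cis (s - t)) (RtoC 1)).
  by rewrite {1}(_ : s = t + (s - t)); [rewrite cisD; ring|ring].
by rewrite Cmod_mult Cmod_cis Rmult_1_l; exact: cis_taylor1.
Qed.

Lemma lip_cis (a : R) : lip (fun t => cis (a * t)).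
Proof.
exists (2 * Rabs a) => s t; apply: Rle_trans (cis_lip _ _) _.
by rewrite -Rmult_minus_distr_l Rabs_mult; lra.
Qed.

Definition Cavg (phi : R -> C) : C :=
  (RInt (fun t => Re (phi t)) 0 (2 * PI) / (2 * PI),
   RInt (fun t => Im (phi t)) 0 (2 * PI) / (2 * PI)).

Lemma Cavg_ext (f g : R -> C) : (forall t, f t = g t) -> Cavg f = Cavg g.
Proof. by move=> e; rewrite (functional_extensionality _ _ e). Qed.

Lemma Cavg_plus (f g : R -> C) : lip f -> lip g ->
  Cavg (fun t => Cplus (f t) (g t)) = Cplus (Cavg f) (Cavg g).
Proof.
move=> hf hg; have pi0 := PI_RGT_0; apply: Ceq => /=;
  rewrite (RInt_plus (V := R_CompleteNormedModule));
  try (by apply: ex_RInt_cont; first [exact: lip_Re|exact: lip_Im]);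
  by rewrite /plus /= /Re /Im; field; lra.
Qed.

Lemma RInt_lin (a b u v : R) (f g : R -> R) :
  (forall t, continuous f t) -> (forall t, continuous g t) ->
  RInt (fun t => a * f t + b * g t) u v = a * RInt f u v + b * RInt g u v.
Proof.
move=> hf hg.
rewrite (RInt_plus (V := R_CompleteNormedModule) (fun t => a * f t) (fun t => b * g t)).
- rewrite (RInt_scal (V := R_CompleteNormedModule) f u v a); last exact: ex_RInt_cont.
  rewrite (RInt_scal (V := R_CompleteNormedModule) g u v b); last exact: ex_RInt_cont.
  by [].
- by apply: ex_RInt_scal; exact: ex_RInt_cont.
- by apply: ex_RInt_scal; exact: ex_RInt_cont.
Qed.

Lemma Cavg_scal (a : C) (f : R -> C) : lip f ->
  Cavg (fun t => Cmult a (f t)) = Cmult a (Cavg f).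
Proof.
move=> hf; have pi0 := PI_RGT_0; have hR := lip_Re _ hf; have hI := lip_Im _ hf.
apply: Ceq => /=.
  rewrite (_ : (fun t => _) = fun t => a.1 * Re (f t) + - a.2 * Im (f t)); last first.
    by apply: functional_extensionality => x; rewrite /Re /Im; ring.
  by rewrite RInt_lin // /Re /Im; field; lra.
rewrite (_ : (fun t => _) = fun t => a.1 * Im (f t) + a.2 * Re (f t)); last first.
  by apply: functional_extensionality => x; rewrite /Re /Im; ring.
by rewrite RInt_lin // /Re /Im; field; lra.
Qed.

Lemma Cavg_conj (f : R -> C) : lip f -> Cavg (fun t => Cconj (f t)) = Cconj (Cavg f).
Proof.
move=> hf; have pi0 := PI_RGT_0; apply: Ceq => //=.
rewrite (RInt_opp (V := R_CompleteNormedModule)); last by apply: ex_RInt_cont; exact: lip_Im.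
by rewrite /opp /= /Im; field; lra.
Qed.

Lemma Cavg_const (a : C) : Cavg (fun _ => a) = a.
Proof.
have pi0 := PI_RGT_0.
by apply: Ceq; rewrite /= RInt_const /scal /= /mult /=; field; lra.
Qed.

Lemma RInt_abs_bound (f : R -> R) (M : R) : (forall t, continuous f t) ->
  (forall t, Rabs (f t) <= M) -> Rabs (RInt f 0 (2 * PI) / (2 * PI)) <= M.
Proof.
move=> cf fM; have pi0 := PI_RGT_0.
have h := abs_RInt_le_const f 0 (2 * PI) M ltac:(lra) (ex_RInt_cont f _ _ cf) (fun t _ => fM t).
rewrite Rabs_div; last lra. rewrite (Rabs_pos_eq (2 * PI)); last lra.
by apply/Rle_div_l; lra.
Qed.

(** The factor 2 comes from bounding the two components separately; over n coordinates it becomes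
    the 2 ^ n of [hat_bound]. *)
Lemma Cavg_bound (f : R -> C) (M : R) : lip f -> (forall t, Cmod (f t) <= M) ->
  Cmod (Cavg f) <= 2 * M.
Proof.
move=> hf fM; apply: Rle_trans (Cmod_le_ReIm _) _.
have h1 : Rabs (Re (Cavg f)) <= M.
  apply: RInt_abs_bound; first exact: lip_Re.
  by move=> t; apply: Rle_trans (re_le_Cmod _) _.
have h2 : Rabs (Im (Cavg f)) <= M.
  apply: RInt_abs_bound; first exact: lip_Im.
  by move=> t; apply: Rle_trans (Im_le_Cmod _) _.
lra.
Qed.

(** The integral over [h, 2 PI + h] is split at 0 and 2 PI; by periodicity the piece beyond 2 PI
    equals the integral over [0, h] and cancels the piece from h to 0. *)
Lemma RInt_periodic_shift (f : R -> R) (h : R) : (forall t, continuous f t) ->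
  (forall t, f (t + 2 * PI) = f t) ->
  RInt (fun t => f (t + h)) 0 (2 * PI) = RInt f 0 (2 * PI).
Proof.
move=> cf pf.
have sh a b v : RInt (fun t => f (t + v)) a b = RInt f (a + v) (b + v).
  have := RInt_comp_lin (V := R_CompleteNormedModule) f 1 v a b.
  rewrite !Rmult_1_l => <-; last exact: ex_RInt_cont.
  by apply: RInt_ext => x _; rewrite /scal /= /mult /= !Rmult_1_l.
have ch a b c : RInt f a b + RInt f b c = RInt f a c.
  by have := RInt_Chasles (V := R_CompleteNormedModule) f a b c (ex_RInt_cont f a b cf)
      (ex_RInt_cont f b c cf).
rewrite sh Rplus_0_l -(ch h 0) -(ch 0 (2 * PI)).
have -> : RInt f (2 * PI) (2 * PI + h) = RInt f 0 h.
  rewrite (Rplus_comm _ h) -{1}(Rplus_0_l (2 * PI)) -sh.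
  by apply: RInt_ext => x _; rewrite pf.
have := ch h 0 h; rewrite RInt_point /zero /=; lra.
Qed.

Lemma Cavg_shift (f : R -> C) (h : R) : lip f -> (forall t, f (t + 2 * PI) = f t) ->
  Cavg (fun t => f (t + h)) = Cavg f.
Proof.
move=> hf pf; apply: Ceq => /=.
  rewrite (RInt_periodic_shift (fun t => Re (f t))) // => t; [exact: lip_Re|by rewrite pf].
rewrite (RInt_periodic_shift (fun t => Im (f t))) // => t; [exact: lip_Im|by rewrite pf].
Qed.

(** * The Fejer kernel *)

Lemma continuous_sum (I : Type) (r : seq I) (F : I -> R -> R) (t : R) :
  (forall i, continuous (F i) t) ->
  continuous (fun t => \big[Rplus/0]_(i <- r) F i t) t.
Proof.
move=> cF; elim: r => [|i r IH].
  apply: (continuous_ext (fun _ => 0)); last exact: continuous_const.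
  by move=> s; rewrite big_nil.
apply: (continuous_ext (fun t => F i t + \big[Rplus/0]_(i <- r) F i t)).
  by move=> s; rewrite big_cons.
exact: (continuous_plus (V := R_NormedModule)).
Qed.

Lemma RInt_sum (I : Type) (r : seq I) (F : I -> R -> R) (a b : R) :
  (forall i t, continuous (F i) t) ->
  RInt (fun t => \big[Rplus/0]_(i <- r) F i t) a b
  = \big[Rplus/0]_(i <- r) RInt (F i) a b.
Proof.
move=> cF; elim: r => [|i r IH].
  rewrite big_nil -(RInt_ext (fun _ => 0)); last by move=> x _; rewrite big_nil.
  by rewrite RInt_const /scal /= /mult /= Rmult_0_r.
have := RInt_lin 1 1 a b _ _ (cF i) (fun t => continuous_sum I r F t (fun i => cF i t)).
rewrite IH !Rmult_1_l big_cons => <-.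
by apply: RInt_ext => x _; rewrite big_cons !Rmult_1_l.
Qed.

Definition dirichlet (N : nat) (t : R) : C :=
  \big[Cplus/RtoC 0]_(k < N) cis (INR k * t).

Lemma dirichlet_closed (N : nat) (t : R) :
  Cmult (Cminus (cis t) (RtoC 1)) (dirichlet N t) = Cminus (cis (INR N * t)) (RtoC 1).
Proof.
rewrite /dirichlet; elim: N => [|N IH].
  by rewrite big_ord0 Rmult_0_l cis0; ring.
rewrite big_ord_recr /= Cmult_plus_distr_l IH -/(INR N.+1) S_INR Rmult_plus_distr_r Rmult_1_l
  cisD; ring.
Qed.

(** N times the usual Fejer kernel, that is (sin(Nt/2) / sin(t/2))^2; being a squared modulus, it is
    nonnegative by construction. *)
Definition fejer (N : nat) (t : R) : R := Cmod (dirichlet N t) ^ 2.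

(** Only cosines of integer frequencies occur, so a function with vanishing cosine coefficients
    integrates to zero against the kernel. *)
Lemma fejerE (N : nat) (t : R) : fejer N t =
  \big[Rplus/0]_(k < N) \big[Rplus/0]_(l < N)
     cos (IZR (Z.of_nat k - Z.of_nat l) * t).
Proof.
rewrite /fejer Cmod2_alt /dirichlet.
rewrite (big_morph Re (op1 := Rplus) (id1 := 0)) //.
rewrite (big_morph Im (op1 := Rplus) (id1 := 0)) // /= !Rmult_1_r !big_distrlr /= -big_split /=.
apply: eq_bigr => k _; rewrite -big_split /=; apply: eq_bigr => l _.
by rewrite minus_IZR -!INR_IZR_INZ Rmult_minus_distr_r cos_minus.
Qed.

Lemma fejer_ge0 (N : nat) (t : R) : 0 <= fejer N t.
Proof. exact: pow2_ge_0. Qed.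

(** The geometric sum telescopes: [cis t - 1], of squared modulus 4 sin(t/2)^2, times
    [dirichlet N t] is a difference of two unimodular numbers, of squared modulus at most 4. *)
Lemma fejer_bound (N : nat) (t : R) : (sin (t / 2)) ^ 2 * fejer N t <= 1.
Proof.
have h : Cmod (Cminus (cis t) (RtoC 1)) ^ 2 = 4 * (sin (t / 2)) ^ 2.
  have e1 : cos t = 1 - 2 * (sin (t / 2)) ^ 2.
    by have -> : cos t = cos (2 * (t / 2)) by [congr cos; field]; rewrite cos_2a_sin; ring.
  have e2 : (sin t) ^ 2 = 1 - (cos t) ^ 2 by have := sin2_cos2 t; rewrite /Rsqr /=; lra.
  rewrite Cmod2_alt /= in e2 *.
  have -> : (sin t + -0) * ((sin t + -0) * 1) = sin t * (sin t * 1) by ring.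
  by rewrite e2 e1; ring.
have : Cmod (Cmult (Cminus (cis t) (RtoC 1)) (dirichlet N t)) <= 2.
  rewrite dirichlet_closed; apply: Rle_trans (Cmod_triangle _ _) _.
  by rewrite Cmod_opp Cmod_1 Cmod_cis; lra.
rewrite Cmod_mult => h2.
have : (Cmod (Cminus (cis t) (RtoC 1)) * Cmod (dirichlet N t)) ^ 2 <= 2 ^ 2.
  by apply: pow_incr; split => //; apply: Rmult_le_pos; exact: Cmod_ge_0.
rewrite Rpow_mult_distr h -/(fejer N t); lra.
Qed.

Lemma continuous_cos_lin (a t : R) : continuous (fun t => cos (a * t)) t.
Proof.
by apply: (ex_derive_continuous (V := R_NormedModule)); auto_derive.
Qed.

Lemma fejer_continuous (N : nat) (t : R) : continuous (fejer N) t.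
Proof.
apply: (continuous_ext (fun t => \big[Rplus/0]_(k < N) \big[Rplus/0]_(l < N)
     cos (IZR (Z.of_nat k - Z.of_nat l) * t))).
  by move=> s; rewrite fejerE.
do 2!apply: continuous_sum => ?; exact: continuous_cos_lin.
Qed.

Lemma RInt_cos (k : Z) : k <> 0%Z -> RInt (fun t => cos (IZR k * t)) 0 (2 * PI) = 0.
Proof.
move=> k0; have kR : IZR k <> 0 by exact: not_0_IZR.
have h : is_RInt (fun t => cos (IZR k * t)) 0 (2 * PI)
   (minus (sin (IZR k * (2 * PI)) / IZR k) (sin (IZR k * 0) / IZR k)).
  apply: (is_RInt_derive (fun t => sin (IZR k * t) / IZR k)) => t _.
    by auto_derive => //; field.
  exact: continuous_cos_lin.
rewrite (is_RInt_unique _ _ _ _ h).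
have := cis_period k 0; rewrite Rplus_0_l => /(f_equal Im) /= ->.
by rewrite Rmult_0_r sin_0 /minus /plus /opp /=; field.
Qed.

(** Of the N^2 cosines only the N diagonal ones, of frequency 0, have a nonzero integral. *)
Lemma RInt_fejer (N : nat) : RInt (fejer N) 0 (2 * PI) = 2 * PI * INR N.
Proof.
rewrite (RInt_ext _ _ _ _ (fun t _ => fejerE N t)) RInt_sum; last first.
  by move=> *; apply: continuous_sum => ?; exact: continuous_cos_lin.
under eq_bigr => k _.
  rewrite RInt_sum; last by move=> *; exact: continuous_cos_lin.
  rewrite (bigD1 k) //= big1 => [|l lk]; last first.
    rewrite RInt_cos // => e; move/eqP: lk; apply; apply: val_inj => /=; lia.
  rewrite Z.sub_diag (RInt_ext _ (fun _ => 1)); last by move=> x _; rewrite Rmult_0_l cos_0.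
  rewrite RInt_const /scal /= /mult /= Rmult_1_r Rplus_0_r Rminus_0_r.
  over.
by rewrite sum_Rconst card_ord; exact: Rmult_comm.
Qed.

(* AM-GM: |sin(t/2)| Q <= (M sin(t/2)^2 Q + Q/M)/2 for the Fejer kernel Q of
   order M^2, which integrates to O(M) while Q itself integrates to 2 pi M^2. *)
Lemma fejer_uniqueness_real (f : R -> R) (K : R) :
  (forall t, continuous f t) ->
  (forall k : Z, RInt (fun t => f t * cos (IZR k * t)) 0 (2 * PI) = 0) ->
  (forall t, 0 <= t <= 2 * PI -> Rabs (f 0 - f t) <= K * Rabs (sin (t / 2))) ->
  f 0 = 0.
Proof.
move=> cf f0 fK; have pi0 := PI_RGT_0.
have K0 : 0 <= K.
  have h := fK PI ltac:(lra); rewrite sin_PI2 Rabs_R1 in h.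
  by have := Rabs_pos (f 0 - f PI); lra.
have ortho N : RInt (fun t => f t * fejer N t) 0 (2 * PI) = 0.
  have cc k t : continuous (fun t => f t * cos (IZR k * t)) t.
    by apply: (continuous_mult (K := R_AbsRing)) => //; exact: continuous_cos_lin.
  rewrite (RInt_ext _ (fun t => \big[Rplus/0]_(k < N) \big[Rplus/0]_(l < N)
     (f t * cos (IZR (Z.of_nat k - Z.of_nat l) * t)))); last first.
    by move=> t _; rewrite fejerE sum_Rmult; apply: eq_bigr => k _; rewrite sum_Rmult.
  rewrite RInt_sum; last by move=> *; apply: continuous_sum => ?; exact: cc.
  by rewrite big1 // => k _; rewrite RInt_sum // big1.
have key (M : R) (N : nat) : 0 < M -> INR N = M * M -> M * Rabs (f 0) <= K.
  move=> M0 NM.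
  have cQ := fejer_continuous N.
  have cfQ t : continuous (fun t => f t * fejer N t) t.
    exact: (continuous_mult (K := R_AbsRing)).
  have e : RInt (fun t => f 0 * fejer N t + -1 * (f t * fejer N t)) 0 (2 * PI)
      = f 0 * (2 * PI * INR N) :> R.
    by rewrite RInt_lin // RInt_fejer ortho; ring.
  have c1 t : continuous (fun t => f 0 * fejer N t + -1 * (f t * fejer N t)) t.
    apply: (continuous_plus (V := R_NormedModule));
      apply: (continuous_mult (K := R_AbsRing)) => //;
    exact: continuous_const.
  have e2 : RInt (fun t => (K * M / 2) * 1 + (K / M / 2) * fejer N t) 0 (2 * PI)
      = 2 * PI * K * M :> R.
    rewrite (RInt_lin _ _ _ _ (fun _ => 1)) //; last by move=> t; exact: continuous_const.
    by rewrite RInt_fejer RInt_const /scal /= /mult /= NM; field; lra.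
  have c2 t : continuous (fun t => (K * M / 2) * 1 + (K / M / 2) * fejer N t) t.
    apply: (continuous_plus (V := R_NormedModule));
      apply: (continuous_mult (K := R_AbsRing)) => //;
    exact: continuous_const.
  have le : Rabs (f 0 * (2 * PI * INR N)) <= 2 * PI * K * M.
    rewrite -e -e2; apply: Rle_trans (abs_RInt_le _ _ _ _ _) _; [lra|exact: ex_RInt_cont|].
    apply: RInt_le; [lra| |exact: ex_RInt_cont|].
      apply: ex_RInt_cont => t.
      by apply: continuous_comp; [exact: c1|exact: continuous_Rabs].
    move=> t ht; have Q0 := fejer_ge0 N t; have Qb := fejer_bound N t.
    have -> : f 0 * fejer N t + -1 * (f t * fejer N t) = (f 0 - f t) * fejer N t by ring.
    rewrite Rabs_mult (Rabs_pos_eq (fejer N t)) //.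
    apply: Rle_trans (Rmult_le_compat_r _ _ _ Q0 (fK t ltac:(lra))) _.
    rewrite -(pow2_abs (sin _)) in Qb.
    move: (Rabs (sin (t / 2))) Qb => s Qb; set Q := fejer N t in Q0 Qb *.
    (* The slack in AM-GM is written as a term that is nonnegative by [fejer_bound] plus a completed
       square. *)
    have -> : K * M / 2 * 1 + K / M / 2 * Q
       = K * s * Q + K / 2 * (M * (1 - s ^ 2 * Q) + Q * (M * s - 1) ^ 2 / M) by field; lra.
    have : 0 <= K / 2 * (M * (1 - s ^ 2 * Q) + Q * (M * s - 1) ^ 2 / M).
      apply: Rmult_le_pos; first lra.
      apply: Rplus_le_le_0_compat; first by apply: Rmult_le_pos; lra.
      apply: Rdiv_le_0_compat => //; apply: Rmult_le_pos => //; exact: pow2_ge_0.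
    lra.
  rewrite Rabs_mult (Rabs_pos_eq (2 * PI * INR N)) in le; last first.
    by apply: Rmult_le_pos; [lra|exact: pos_INR].
  rewrite NM in le; apply: (Rmult_le_reg_l (2 * PI * M)); first nra.
  by lra.
have [->|fn] := Req_dec (f 0) 0; first by [].
have a0 : 0 < Rabs (f 0) by exact: Rabs_pos_lt.
(* Taking N = m * m makes the integer m an exact square root of the order, and m exceeding K / |f 0|
   contradicts [key]. *)
have [m hm] := INR_unbounded (K / Rabs (f 0)).
have m0 : 0 < INR m by have := Rdiv_le_0_compat K (Rabs (f 0)) K0 a0; lra.
have := key (INR m) (m * m)%N m0 (mult_INR m m).
move/Rlt_div_l: hm => /(_ a0); lra.
Qed.

(** From sin y >= y - y^3/6 and y <= PI/2 <= 2 comes the constant 1 - 4/6 = 1/3. *)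
Lemma sin_lower (y : R) : 0 <= y <= PI / 2 -> y / 3 <= sin y.
Proof.
move=> [y0 y2]; have := PI_4 => p4.
have [h _] := pre_sin_bound y 0 y0 ltac:(lra).
apply: Rle_trans h; rewrite /sin_approx /sin_term /=.
nra.
Qed.

(** The Lipschitz bound is K t measured from 0 and, by periodicity, K (2 PI - t) measured from 2 PI.
    On the half where each is used, the half-angle is at most PI/2, and [sin_lower] turns the
    distance into 6 sin(t/2). *)
Lemma lip_periodic_half_sine (f : R ->
  R) (K : R) : (forall s t, Rabs (f s - f t) <= K * Rabs (s - t)) ->
  (forall t, f (t + 2 * PI) = f t) ->
  forall t, 0 <= t <= 2 * PI -> Rabs (f 0 - f t) <= 6 * K * Rabs (sin (t / 2)).
Proof.
move=> fK pf t ht; have pi0 := PI_RGT_0.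
have K0 : 0 <= K.
  by have := fK 1 0; rewrite Rminus_0_r Rabs_R1; have := Rabs_pos (f 1 - f 0); lra.
have sp : 0 <= sin (t / 2) by apply: sin_ge_0; lra.
rewrite (Rabs_pos_eq (sin _)) //.
case: (Rle_dec t PI) => hp.
  have := fK 0 t; rewrite Rabs_minus_sym (Rabs_minus_sym 0) Rminus_0_r (Rabs_pos_eq t); last lra.
  have := sin_lower (t / 2) ltac:(lra); rewrite Rabs_minus_sym; nra.
have <- : f (0 + 2 * PI) = f 0 by exact: pf.
have := fK (0 + 2 * PI) t; rewrite Rplus_0_l (Rabs_pos_eq (2 * PI - t)); last lra.
have := sin_lower (PI - t / 2) ltac:(lra); rewrite sin_PI_x; nra.
Qed.

Lemma Cavg_eq0 (f : R -> C) : Cavg f = RtoC 0 ->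
  RInt (fun t => Re (f t)) 0 (2 * PI) = 0 :> R /\
  RInt (fun t => Im (f t)) 0 (2 * PI) = 0 :> R.
Proof.
move=> [h1 h2]; have pi0 := PI_RGT_0.
have i0 : / (2 * PI) <> 0 by apply: Rinv_neq_0_compat; lra.
by split; apply: (Rmult_eq_reg_r (/ (2 * PI))) => //; rewrite Rmult_0_l.
Qed.

(** The mean of the coefficients at k and -k has the real weight cos(kt), which separates the
    components of [f]. The value at 0 is enough, because later the slice is based at the point of
    interest. *)
Lemma fejer_uniqueness (f : R -> C) (M : R) :
  lip f -> (forall t, Cmod (f t) <= M) -> (forall t, f (t + 2 * PI) = f t) ->
  (forall k : Z, Cavg (fun t => Cmult (f t) (cis (- IZR k * t))) = RtoC 0) ->
  f 0 = RtoC 0.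
Proof.
move=> lf fM pf f0; have pi0 := PI_RGT_0.
have lfc k : lip (fun t => Cmult (f t) (cis (- IZR k * t))).
  apply: (lip_mult _ _ M 1) => //; [by move=> t; rewrite Cmod_cis; lra|exact: lip_cis].
have fc k : Cavg (fun t => Cmult (f t) (RtoC (cos (IZR k * t)))) = RtoC 0.
  rewrite (Cavg_ext _ (fun t => Cplus (Cmult (RtoC (/ 2)) (Cmult (f t) (cis (- IZR k * t))))
     (Cmult (RtoC (/ 2)) (Cmult (f t) (cis (- IZR (- k) * t)))))).
    rewrite Cavg_plus; try exact: lip_scal.
    by rewrite !Cavg_scal // !f0; ring.
  move=> t; rewrite opp_IZR Ropp_involutive -Ropp_mult_distr_l cisN.
  by apply: Ceq => /=; field.
have [K lK] := lf.
apply: Ceq.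
  apply: (fejer_uniqueness_real (fun t => Re (f t)) (6 * K)); first exact: lip_Re.
    move=> k; have [h _] := Cavg_eq0 _ (fc k).
    apply: etrans h; apply: RInt_ext.
      by move=> t _; rewrite /= Rmult_0_r Rminus_0_r.
  apply: lip_periodic_half_sine => [s t|t]; last by rewrite pf.
  by apply: Rle_trans (lK s t); exact: (re_le_Cmod (Cminus (f s) (f t))).
apply: (fejer_uniqueness_real (fun t => Im (f t)) (6 * K)); first exact: lip_Im.
  move=> k; have [_ h] := Cavg_eq0 _ (fc k).
  apply: etrans h; apply: RInt_ext.
    by move=> t _; rewrite /= Rmult_0_r Rplus_0_l.
apply: lip_periodic_half_sine => [s t|t]; last by rewrite pf.
by apply: Rle_trans (lK s t); exact: (Im_le_Cmod (Cminus (f s) (f t))).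
Qed.

(** * Fourier coefficients *)

(** Unlike [update], which overwrites a coordinate, translations compose additively and commute; the
    invariance arguments rest on this. *)
Definition shift {n} (x : point n) (j : 'I_n) (h : R) : point n := update x j (x j + h).

Lemma shiftE {n} (x : point n) (j k : 'I_n) (h : R) :
  shift x j h k = x k + (if k == j then h else 0).
Proof. by rewrite /shift /update; case: eqP => [->|_] //; ring. Qed.

Lemma shift0 {n} (x : point n) (j : 'I_n) : shift x j 0 = x.
Proof. by apply: functional_extensionality => k; rewrite shiftE; case: ifP => _; ring. Qed.

Lemma shiftD {n} (x : point n) (j : 'I_n) (a b : R) :
  shift (shift x j a) j b = shift x j (a + b).
Proof. by apply: functional_extensionality => k; rewrite !shiftE; case: ifP => _; ring. Qed.

Lemma shiftC {n} (x : point n) (j l : 'I_n) (a b : R) :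
  shift (shift x j a) l b = shift (shift x l b) j a.
Proof. by apply: functional_extensionality => k; rewrite !shiftE; ring. Qed.

(** One constant serves the sup bound and the Lipschitz bounds in all directions. The class is
    stable under partial averages, so coefficients can be handled without proving those averages
    smooth. *)
Definition tame {n} (u : point n -> C) : Prop :=
  periodic u /\ exists K : R, (forall x, Cmod (u x) <= K) /\
    forall x j h, Cmod (Cminus (u (shift x j h)) (u x)) <= K * Rabs h.

Lemma tame_plus {n} (u v : point n -> C) : tame u -> tame v ->
  tame (fun x => Cplus (u x) (v x)).
Proof.
move=> [pu [K [bu lu]]] [pv [L [bv lv]]]; split; first by move=> x j; rewrite pu pv.
exists (K + L); split=> [x|x j h].
  by apply: Rle_trans (Cmod_triangle _ _) _; apply: Rplus_le_compat.
have -> : Cminus (Cplus (u (shift x j h)) (v (shift x j h))) (Cplus (u x) (v x))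
  = Cplus (Cminus (u (shift x j h)) (u x)) (Cminus (v (shift x j h)) (v x)) by ring.
by apply: Rle_trans (Cmod_triangle _ _) _; rewrite Rmult_plus_distr_r; apply: Rplus_le_compat.
Qed.

Lemma tame_scal {n} (a : C) (u : point n -> C) : tame u -> tame (fun x => Cmult a (u x)).
Proof.
move=> [pu [K [bu lu]]]; split; first by move=> x j; rewrite pu.
have a0 := Cmod_ge_0 a.
exists (Cmod a * K); split=> [x|x j h]; first by rewrite Cmod_mult; apply: Rmult_le_compat_l.
have -> : Cminus (Cmult a (u (shift x j h))) (Cmult a (u x))
  = Cmult a (Cminus (u (shift x j h)) (u x)) by ring.
by rewrite Cmod_mult Rmult_assoc; apply: Rmult_le_compat_l.
Qed.

Lemma tame_minus {n} (u v : point n -> C) : tame u -> tame v ->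
  tame (fun x => Cminus (u x) (v x)).
Proof.
move=> tu tv; have -> : (fun x => Cminus (u x) (v x))
   = (fun x => Cplus (u x) (Cmult (RtoC (-1)) (v x))).
  by apply: functional_extensionality => x; apply: Ceq; rewrite /=; ring.
by apply: tame_plus => //; exact: tame_scal.
Qed.

Lemma tame_conj {n} (u : point n -> C) : tame u -> tame (fun x => Cconj (u x)).
Proof.
move=> [pu [K [bu lu]]]; split; first by move=> x j; rewrite pu.
exists K; split=> [x|x j h]; first by rewrite Cmod_conj.
rewrite (_ : Cminus _ _ = Cconj (Cminus (u (shift x j h)) (u x))); first by rewrite Cmod_conj.
by apply: Ceq; rewrite /=; ring.
Qed.

Lemma tame_zero {n} : tame (fun _ : point n => RtoC 0).
Proof.
split=> //; exists 0; split=> *; rewrite ?Cmod_0; try lra.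
by rewrite (_ : Cminus _ _ = RtoC 0) ?Cmod_0; [lra|ring].
Qed.

Lemma tame_sum {n} (I : Type) (r : seq I) (P : pred I) (u : I -> point n -> C) :
  (forall i, tame (u i)) ->
  tame (fun x => \big[Cplus/RtoC 0]_(i <- r | P i) u i x).
Proof.
move=> tu; elim: r => [|i r IH].
  rewrite (_ : (fun x => _) = fun _ => RtoC 0); first exact: tame_zero.
  by apply: functional_extensionality => x; rewrite big_nil.
rewrite (_ : (fun x => _) = fun x => if P i then Cplus (u i x) (\big[Cplus/RtoC 0]_(i <- r |
  P i) u i x)
   else \big[Cplus/RtoC 0]_(i <- r | P i) u i x); last first.
  by apply: functional_extensionality => x; rewrite big_cons.
by case: (P i) => //; exact: tame_plus.
Qed.

Lemma tame_shift {n} (u : point n -> C) (j : 'I_n) (h : R) :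
  tame u -> tame (fun x => u (shift x j h)).
Proof.
move=> [pu [K [bu lu]]]; split.
  by move=> x l; rewrite -/(shift x l (2 * PI)) shiftC; exact: pu.
by exists K; split=> [x|x l k]; [exact: bu|rewrite shiftC; exact: lu].
Qed.

Lemma slice_lip {n} (u : point n -> C) (x : point n) (j : 'I_n) : tame u ->
  lip (fun t => u (shift x j t)).
Proof.
move=> [_ [K [_ lu]]]; exists K => s t.
have -> : shift x j s = shift (shift x j t) j (s - t) by rewrite shiftD; congr shift; ring.
exact: lu.
Qed.

Lemma twisted_slice_lip {n} (u : point n -> C) (x : point n) (j : 'I_n) (a : R) : tame u ->
  lip (fun t => Cmult (u (shift x j t)) (cis (a * t))).
Proof.
move=> tu; have [_ [K [bu _]]] := tu.
apply: (lip_mult _ _ K 1); [by []|by move=> t; rewrite Cmod_cis;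
  lra|exact: slice_lip|exact: lip_cis].
Qed.

Lemma twisted_slice_periodic {n} (u : point n -> C) (x : point n) (j : 'I_n) (k : Z) (t : R) :
  periodic u ->
  Cmult (u (shift x j (t + 2 * PI))) (cis (- IZR k * (t + 2 * PI)))
  = Cmult (u (shift x j t)) (cis (- IZR k * t)).
Proof.
move=> pu; rewrite -shiftD [in LHS]/shift pu; congr Cmult.
by rewrite Rmult_plus_distr_l -opp_IZR cis_period.
Qed.

(** The result stays a function of all n variables: it is the projection onto the functions of
    frequency [k] in the coordinate [j]. The dimension never changes, and projections iterate by a
    plain [foldr]. *)
Definition proj {n} (j : 'I_n) (k : Z) (u : point n -> C) : point n -> C :=
  fun x => Cavg (fun t => Cmult (u (shift x j t)) (cis (- IZR k * t))).

(** An increment of the average is the average of the increments, since translations commute; so the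
    Lipschitz constant at most doubles. *)
Lemma proj_tame {n} (j : 'I_n) (k : Z) (u : point n -> C) : tame u -> tame (proj j k u).
Proof.
move=> tu; have [pu [K [bu lu]]] := tu; split.
  move=> x l; apply: Cavg_ext => t; congr Cmult.
  by rewrite -/(shift x l (2 * PI)) shiftC; exact: pu.
have K0 : 0 <= K by apply: Rle_trans (bu (fun _ => 0)); exact: Cmod_ge_0.
exists (2 * K); split=> [x|x l h].
  apply: Cavg_bound; first exact: twisted_slice_lip.
  by move=> t; rewrite Cmod_mult Cmod_cis Rmult_1_r.
rewrite /proj (_ : Cminus _ _ = Cavg (fun t => Cplus
   (Cmult (u (shift (shift x l h) j t)) (cis (- IZR k * t)))
   (Cmult (RtoC (-1)) (Cmult (u (shift x j t)) (cis (- IZR k * t)))))); last first.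
  rewrite Cavg_plus; [|exact: twisted_slice_lip|by apply: lip_scal; exact: twisted_slice_lip].
  rewrite Cavg_scal; last exact: twisted_slice_lip.
  by apply: Ceq; rewrite /=; ring.
rewrite Rmult_assoc; apply: Cavg_bound.
  by apply: lip_plus; [|apply: lip_scal]; exact: twisted_slice_lip.
move=> t; rewrite shiftC (_ : Cplus _ _ =
  Cmult (Cminus (u (shift (shift x j t) l h)) (u (shift x j t))) (cis (- IZR k * t))).
  by rewrite Cmod_mult Cmod_cis Rmult_1_r.
by apply: Ceq; rewrite /=; ring.
Qed.

Lemma proj_plus {n} (j : 'I_n) (k : Z) (u v : point n -> C) : tame u -> tame v ->
  proj j k (fun x => Cplus (u x) (v x)) = fun x => Cplus (proj j k u x) (proj j k v x).
Proof.
move=> tu tv; apply: functional_extensionality => x.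
rewrite /proj -Cavg_plus; try exact: twisted_slice_lip.
by apply: Cavg_ext => t; ring.
Qed.

Lemma proj_scal {n} (j : 'I_n) (k : Z) (a : C) (u : point n -> C) : tame u ->
  proj j k (fun x => Cmult a (u x)) = fun x => Cmult a (proj j k u x).
Proof.
move=> tu; apply: functional_extensionality => x.
rewrite /proj -Cavg_scal; try exact: twisted_slice_lip.
by apply: Cavg_ext => t; ring.
Qed.

Lemma proj_conj {n} (j : 'I_n) (k : Z) (u : point n -> C) : tame u ->
  proj j k (fun x => Cconj (u x)) = fun x => Cconj (proj j (- k) u x).
Proof.
move=> tu; apply: functional_extensionality => x.
rewrite /proj -Cavg_conj; last exact: twisted_slice_lip.
apply: Cavg_ext => t; rewrite -Ropp_mult_distr_l cisN opp_IZR Ropp_involutive.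
by apply: Ceq => /=; ring.
Qed.

Lemma proj_shift {n} (j : 'I_n) (k : Z) (l : 'I_n) (h : R) (u : point n -> C) :
  proj j k (fun x => u (shift x l h)) = fun x => proj j k u (shift x l h).
Proof.
by apply: functional_extensionality => x; apply: Cavg_ext => t; rewrite shiftC.
Qed.

(** Moving the base point along [j] translates the slice; invariance of the average over a period
    leaves only the phase of the exponential. *)
Lemma proj_eigen {n} (j : 'I_n) (k : Z) (u : point n -> C) (x : point n) (h : R) : tame u ->
  proj j k u (shift x j h) = Cmult (cis (IZR k * h)) (proj j k u x).
Proof.
move=> tu; have [pu _] := tu.
rewrite /proj -(Cavg_shift (fun t => Cmult (u (shift x j t)) (cis (- IZR k * t))) h);
  [|exact: twisted_slice_lip|by move=> t; exact: twisted_slice_periodic].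
rewrite -Cavg_scal; last first.
  have [K H] := twisted_slice_lip u x j (- IZR k) tu.
  exists K => s t; apply: Rle_trans (H _ _) _.
  by apply: Req_le; congr (_ * Rabs _); ring.
apply: Cavg_ext => t; rewrite shiftD (Rplus_comm h).
rewrite [RHS](_ : _ = Cmult (u (shift x j (t + h)))
  (Cmult (cis (IZR k * h)) (cis (- IZR k * (t + h))))); last by ring.
by rewrite -cisD; congr Cmult; congr cis; ring.
Qed.

Lemma proj_uniqueness {n} (j : 'I_n) (u : point n -> C) (x : point n) : tame u ->
  (forall k, proj j k u x = RtoC 0) -> u x = RtoC 0.
Proof.
move=> tu u0; have [pu [K [bu _]]] := tu.
rewrite -(shift0 x j); apply: (fejer_uniqueness (fun t => u (shift x j t)) K) => //.
  exact: slice_lip.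
by move=> t; rewrite -shiftD [in LHS]/shift pu.
Qed.

Definition projs {n} (xi : freq n) (s : seq 'I_n) (u : point n -> C) : point n -> C :=
  foldr (fun j => proj j (xi j)) u s.

Lemma projs_tame {n} (xi : freq n) (s : seq 'I_n) (u : point n -> C) :
  tame u -> tame (projs xi s u).
Proof. by move=> tu; elim: s => //= j s IH; exact: proj_tame. Qed.

Lemma projs_plus {n} (xi : freq n) (s : seq 'I_n) (u v : point n -> C) : tame u -> tame v ->
  projs xi s (fun x => Cplus (u x) (v x)) = fun x => Cplus (projs xi s u x) (projs xi s v x).
Proof. by move=> tu tv; elim: s => //= j s ->; rewrite proj_plus //; exact: projs_tame. Qed.

Lemma projs_scal {n} (xi : freq n) (s : seq 'I_n) (a : C) (u : point n -> C) : tame u ->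
  projs xi s (fun x => Cmult a (u x)) = fun x => Cmult a (projs xi s u x).
Proof. by move=> tu; elim: s => //= j s ->; rewrite proj_scal //; exact: projs_tame. Qed.

Lemma projs_conj {n} (xi : freq n) (s : seq 'I_n) (u : point n -> C) : tame u ->
  projs xi s (fun x => Cconj (u x)) = fun x => Cconj (projs (freq_opp xi) s u x).
Proof. by move=> tu; elim: s => //= j s ->; rewrite proj_conj //; exact: projs_tame. Qed.

Lemma projs_shift {n} (xi : freq n) (s : seq 'I_n) (l : 'I_n) (h : R) (u : point n -> C) :
  projs xi s (fun x => u (shift x l h)) = fun x => projs xi s u (shift x l h).
Proof. by elim: s => //= j s ->; rewrite proj_shift. Qed.

(** The phase arises at a projection along [l]; the outer projections commute with the translation
    and are linear, so the phase passes through them. *)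
Lemma projs_eigen {n} (xi : freq n) (s : seq 'I_n) (l : 'I_n) (h : R) (u : point n -> C)
  (x : point n) : tame u -> l \in s ->
  projs xi s u (shift x l h) = Cmult (cis (IZR (xi l) * h)) (projs xi s u x).
Proof.
move=> tu; elim: s x => //= j s IH x; rewrite in_cons => /orP[/eqP ->|ls].
  by apply: proj_eigen; exact: projs_tame.
have /= <- := f_equal (fun F => F x) (proj_shift j (xi j) l h (projs xi s u)).
rewrite (_ : (fun x => _) = fun x => Cmult (cis (IZR (xi l) * h)) (projs xi s u x)); last first.
  by apply: functional_extensionality => y; exact: IH.
by rewrite proj_scal //; exact: projs_tame.
Qed.

Lemma projs_bound {n} (xi : freq n) (s : seq 'I_n) (u : point n -> C) (M : R) : tame u ->
  (forall x, Cmod (u x) <= M) -> forall x, Cmod (projs xi s u x) <= 2 ^ size s * M.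
Proof.
move=> tu uM; elim: s => [|j s IH] x /=; first by rewrite Rmult_1_l.
rewrite Rmult_assoc; apply: Cavg_bound.
  by apply: twisted_slice_lip; exact: projs_tame.
by move=> t; rewrite Cmod_mult Cmod_cis Rmult_1_r.
Qed.

Lemma projs_uniqueness {n} (s : seq 'I_n) (u : point n -> C) : tame u -> uniq s ->
  (forall xi x, projs xi s u x = RtoC 0) -> forall x, u x = RtoC 0.
Proof.
move=> tu; elim: s => [|j s IH] /= => [_ H x|/andP[js us] H]; first exact: (H (fun _ => 0%Z)).
apply: IH => // xi x; apply: (proj_uniqueness j); first exact: projs_tame.
(* Since [j] is not in the rest of the list, its frequency can vary while the inner projections stay
   unchanged. *)
move=> k; have := H (fun l => if l == j then k else xi l) x; rewrite eqxx.
suff -> : projs (fun l => if l == j then k else xi l) s u = projs xi s u by [].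
elim: s js {us H} => //= l s IH; rewrite in_cons negb_or => /andP[lj js].
by rewrite IH // eq_sym (negbTE lj).
Qed.

(** After projection along every coordinate only a multiple of the character of [xi] is left; its
    value at the origin is the Fourier coefficient. *)
Definition hat {n} (u : point n -> C) (xi : freq n) : C :=
  projs xi (enum 'I_n) u (fun _ => 0).

Lemma hat_plus {n} (u v : point n -> C) (xi : freq n) : tame u -> tame v ->
  hat (fun x => Cplus (u x) (v x)) xi = Cplus (hat u xi) (hat v xi).
Proof. by move=> tu tv; rewrite /hat projs_plus. Qed.

Lemma hat_scal {n} (a : C) (u : point n -> C) (xi : freq n) : tame u ->
  hat (fun x => Cmult a (u x)) xi = Cmult a (hat u xi).
Proof. by move=> tu; rewrite /hat projs_scal. Qed.

Lemma hat_minus {n} (u v : point n -> C) (xi : freq n) : tame u -> tame v ->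
  hat (fun x => Cminus (u x) (v x)) xi = Cminus (hat u xi) (hat v xi).
Proof.
move=> tu tv; have -> : (fun x => Cminus (u x) (v x))
   = (fun x => Cplus (u x) (Cmult (RtoC (-1)) (v x))).
  by apply: functional_extensionality => x; apply: Ceq; rewrite /=; ring.
rewrite hat_plus ?hat_scal //; first by apply: Ceq; rewrite /=; ring.
exact: tame_scal.
Qed.

Lemma hat_conj {n} (u : point n -> C) (xi : freq n) : tame u ->
  hat (fun x => Cconj (u x)) xi = Cconj (hat u (freq_opp xi)).
Proof. by move=> tu; rewrite /hat projs_conj. Qed.

Lemma hat_zero {n} (xi : freq n) : hat (fun _ => RtoC 0) xi = RtoC 0.
Proof.
by have := hat_scal (RtoC 0) _ xi (@tame_zero n); rewrite !Cmult_0_l.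
Qed.

Lemma hat_sum {n} (I : Type) (r : seq I) (P : pred I) (u : I -> point n -> C) (xi : freq n) :
  (forall i, tame (u i)) ->
  hat (fun x => \big[Cplus/RtoC 0]_(i <- r | P i) u i x) xi
  = \big[Cplus/RtoC 0]_(i <- r | P i) hat (u i) xi.
Proof.
move=> tu; elim: r => [|i r IH].
  rewrite big_nil (_ : (fun x => _) = fun _ => RtoC 0); first exact: hat_zero.
  by apply: functional_extensionality => x; rewrite big_nil.
rewrite big_cons -IH.
rewrite (_ : (fun x => _) = fun x => if P i then Cplus (u i x) (\big[Cplus/RtoC 0]_(i <- r |
  P i) u i x)
   else \big[Cplus/RtoC 0]_(i <- r | P i) u i x); last first.
  by apply: functional_extensionality => x; rewrite big_cons.
by case: (P i) => //; rewrite hat_plus //; exact: tame_sum.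
Qed.

Lemma hat_shift {n} (u : point n -> C) (xi : freq n) (l : 'I_n) (h : R) : tame u ->
  hat (fun x => u (shift x l h)) xi = Cmult (cis (IZR (xi l) * h)) (hat u xi).
Proof. by move=> tu; rewrite /hat projs_shift projs_eigen // mem_enum. Qed.

Lemma hat_bound {n} (u : point n -> C) (xi : freq n) (M : R) : tame u ->
  (forall x, Cmod (u x) <= M) -> Cmod (hat u xi) <= 2 ^ n * M.
Proof.
by move=> tu uM; have := projs_bound xi (enum 'I_n) u M tu uM (fun _ => 0); rewrite size_enum_ord.
Qed.

Lemma hat_uniqueness {n} (u : point n -> C) : tame u ->
  (forall xi, hat u xi = RtoC 0) -> forall x, u x = RtoC 0.
Proof.
move=> tu u0; apply: (projs_uniqueness (enum 'I_n)) => //; first exact: enum_uniq.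
move=> xi x.
(* The point [x] is reached from the origin one coordinate at a time. Each translation multiplies
   the full projection by a phase; a coordinate met twice is translated by 0. *)
have H (s : seq 'I_n) : exists w, projs xi (enum 'I_n) u (fun j => if j \in s then x j else 0)
  = Cmult w (hat u xi).
  elim: s => [|j s [w e]]; first by exists (RtoC 1); rewrite Cmult_1_l.
  exists (Cmult (cis (IZR (xi j) * (if j \in s then 0 else x j))) w).
  rewrite -Cmult_assoc -e -projs_eigen ?mem_enum //; congr projs.
  apply: functional_extensionality => k; rewrite shiftE in_cons.
  by case: eqP => [->|_] /=; case: (_ \in s); ring.
have [w] := H (enum 'I_n); rewrite u0 Cmult_0_r => <-; congr projs.
by apply: functional_extensionality => j; rewrite mem_enum.
Qed.

Lemma hat_deriv {n} (u v : point n -> C) (xi : freq n) (l : 'I_n) (K : R) : tame u -> tame v ->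
  (forall x h, Cmod (Cminus (Cminus (u (shift x l h)) (u x)) (Cmult (RtoC h) (v x)))
    <= K * h ^ 2) ->
  hat v xi = Cmult (Cmult Ci (RtoC (IZR (xi l)))) (hat u xi).
Proof.
move=> tu tv H; set k := IZR (xi l); set a := hat u xi.
suff : Cmod (Cminus (hat v xi) (Cmult (Cmult Ci (RtoC k)) a)) = 0.
  by move/Cmod_eq_0 => e; rewrite (_ : hat v xi
    = Cplus (Cminus (hat v xi) (Cmult (Cmult Ci (RtoC k)) a))
    (Cmult (Cmult Ci (RtoC k)) a)); [rewrite e; ring|ring].
set d := Cmod _; have d0 : 0 <= d by exact: Cmod_ge_0.
(* The two quadratic errors in h: the Taylor remainder of [u], seen through [hat_bound], and that of
   [cis (k * h)], multiplied by the coefficient of [u]. *)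
set L := 2 ^ n * K + 2 * k ^ 2 * Cmod a.
have key h : 0 < h -> d <= L * h.
  move=> h0.
  have tsh := tame_shift _ l h tu.
  have t1 := tame_minus _ _ tsh tu; have t2 := tame_scal (RtoC h) _ tv.
  have b := hat_bound _ xi _ (tame_minus _ _ t1 t2) (fun x => H x h).
  rewrite hat_minus // hat_minus // hat_scal // hat_shift // -/k -/a in b.
  have c := cis_taylor2 (k * h).
  have e : Cmult (RtoC h) (Cminus (hat v xi) (Cmult (Cmult Ci (RtoC k)) a)) =
    Cminus (Cmult (Cminus (Cminus (cis (k * h)) (RtoC 1)) (Cmult Ci (RtoC (k * h)))) a)
           (Cminus (Cminus (Cmult (cis (k * h)) a) a) (Cmult (RtoC h) (hat v xi))).
    by rewrite RtoC_mult; ring.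
  have : h * d <= h * (L * h).
    rewrite -{1}(Rabs_pos_eq h); last lra.
    rewrite /d -Cmod_R -Cmod_mult e; apply: Rle_trans (Cmod_triangle _ _) _.
    rewrite Cmod_opp Cmod_mult.
    have a0 := Cmod_ge_0 a; have := Rmult_le_compat_r _ _ _ a0 c; rewrite /L; nra.
  by apply: Rmult_le_reg_l.
apply: Rle_antisym => //; apply: Rnot_lt_le => dp.
have L0 : 0 < Rabs L + 1 by have := Rabs_pos L; lra.
(* With this h the bound L h is at most d / 2, which contradicts d > 0. *)
have h0 : 0 < d / (Rabs L + 1) / 2 by do 2!(apply: Rdiv_lt_0_compat => //; try lra).
have := key _ h0.
have : L * (d / (Rabs L + 1) / 2) <= (Rabs L + 1) * (d / (Rabs L + 1) / 2).
  by apply: Rmult_le_compat_r; [lra|have := Rle_abs L; lra].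
rewrite (_ : (Rabs L + 1) * _ = d / 2); last by field; lra.
lra.
Qed.

(** * Smooth functions on the torus *)

Lemma is_derive_Re (f : R -> C) (t : R) (l : C) :
  @is_derive R_AbsRing C_R_NormedModule f t l -> is_derive (fun s => Re (f s)) t (Re l).
Proof.
move=> h; apply: (filterdiff_ext_lin _ (fun y => fst (@scal _ C_R_NormedModule y l))) => //.
apply: (filterdiff_comp' f fst); first exact: h.
by apply: filterdiff_linear; exact: is_linear_fst.
Qed.

Lemma is_derive_Im (f : R -> C) (t : R) (l : C) :
  @is_derive R_AbsRing C_R_NormedModule f t l -> is_derive (fun s => Im (f s)) t (Im l).
Proof.
move=> h; apply: (filterdiff_ext_lin _ (fun y => snd (@scal _ C_R_NormedModule y l))) => //.
apply: (filterdiff_comp' f snd); first exact: h.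
by apply: filterdiff_linear; exact: is_linear_snd.
Qed.

Lemma Derive_translate (f : R -> R) (a b : R) :
  Derive f (a + b) = Derive (fun h => f (a + h)) b.
Proof. by rewrite /Derive; congr (real _); apply: Lim_ext => h; rewrite Rplus_assoc. Qed.

Lemma partialE {n} (j : 'I_n) (u : point n -> C) (x : point n) :
  partial j u x = (Derive (fun h => Re (u (shift x j h))) 0,
                   Derive (fun h => Im (u (shift x j h))) 0).
Proof. by rewrite /partial -{1 2}(Rplus_0_r (x j)) !Derive_translate. Qed.

Lemma update_shift {n} (x : point n) (j : 'I_n) (h t : R) :
  update (shift x j h) j t = update x j t.
Proof. by apply: functional_extensionality => k; rewrite /shift /update; case: eqP. Qed.

Lemma ex_partial_derive {n} (j : 'I_n) (u : point n -> C) (x : point n) (h : R) :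
  ex_partial j u (shift x j h) ->
  is_derive (fun t => Re (u (shift x j t))) h (Re (partial j u (shift x j h))) /\
  is_derive (fun t => Im (u (shift x j t))) h (Im (partial j u (shift x j h))).
Proof.
move=> [l]; rewrite shiftE eqxx.
rewrite (_ : (fun t => u (update (shift x j h) j t)) = fun t => u (update x j t)); last first.
  by apply: functional_extensionality => t; rewrite update_shift.
move=> hl.
have tr (g : R -> R) (d : R) : is_derive g (x j + h) d -> is_derive (fun t => g (x j + t)) h d.
  move=> hg.
  have := is_derive_comp (V := R_NormedModule) g (fun t => x j + t) h d 1 hg.
  rewrite /scal /= /mult /= Rmult_1_l; apply.
  by auto_derive => //; ring.
have e1 := tr _ _ (is_derive_Re _ _ _ hl); have e2 := tr _ _ (is_derive_Im _ _ _ hl).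
have P (g : R -> R) (d : R) : is_derive (fun t => g t) h d ->
    is_derive g h (Derive (fun t => g (h + t)) 0).
  by move=> hg; rewrite -Derive_translate Rplus_0_r; apply: Derive_correct; exists d.
have E1 : Re (partial j u (shift x j h)) = Derive (fun k => Re (u (shift x j (h + k)))) 0.
  by rewrite partialE; congr (Derive _ _); apply: functional_extensionality => k; rewrite shiftD.
have E2 : Im (partial j u (shift x j h)) = Derive (fun k => Im (u (shift x j (h + k)))) 0.
  by rewrite partialE; congr (Derive _ _); apply: functional_extensionality => k; rewrite shiftD.
rewrite E1 E2; split.
  exact: (P (fun t => Re (u (shift x j t))) _ e1).
exact: (P (fun t => Im (u (shift x j t))) _ e2).
Qed.

Lemma Cinfty_partial {n} (j : 'I_n) (u : point n -> C) :
  Cinfty_torus u -> Cinfty_torus (partial j u).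
Proof.
move=> [pu su]; split.
  move=> x l; rewrite -/(shift x l (2 * PI)) !partialE.
  have e : (fun h => u (shift (shift x l (2 * PI)) j h)) = fun h => u (shift x j h).
    by apply: functional_extensionality => h; rewrite shiftC; exact: pu.
  by congr pair; congr (Derive _ _); apply: functional_extensionality => h;
    rewrite shiftC /shift pu.
(* The last letter of a word is differentiated first, so [j] is appended at the end. *)
by move=> s x; have := su (s ++ [:: j]) x; rewrite /iter_partial foldr_cat.
Qed.

Lemma Cinfty_iter_partial {n} (s : seq 'I_n) (u : point n -> C) :
  Cinfty_torus u -> Cinfty_torus (iter_partial s u).
Proof. by move=> cu; elim: s => //= j s IH; exact: Cinfty_partial. Qed.

Lemma periodic_Z {n} (u : point n -> C) (x : point n) (j : 'I_n) (k : Z) :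
  periodic u -> u (shift x j (IZR k * (2 * PI))) = u x.
Proof.
move=> pu.
suff H (m : nat) y : u (shift y j (INR m * (2 * PI))) = u y.
  case: (Z_le_gt_dec 0 k) => hk.
    by rewrite -(Z2Nat.id k) // -INR_IZR_INZ H.
  rewrite -(H (Z.to_nat (- k)) (shift x j _)) INR_IZR_INZ Z2Nat.id; last lia.
  by rewrite opp_IZR shiftD -[in RHS](shift0 x j); congr (u (shift _ _ _)); ring.
elim: m y => [|m IH] y; first by rewrite Rmult_0_l shift0.
by rewrite S_INR Rmult_plus_distr_r Rmult_1_l -shiftD [LHS]pu.
Qed.

Lemma periodic_box {n} (u : point n -> C) (s : seq 'I_n) (x : point n) : periodic u ->
  exists y : point n, u y = u x /\ forall j, j \in s -> 0 <= y j <= 2 * PI.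
Proof.
move=> pu; have pi0 := PI_RGT_0; elim: s => [|j s [y [uy hy]]]; first by exists x.
set k := Int_part (y j / (2 * PI)).
exists (shift y j (IZR (- k) * (2 * PI))); split; first by rewrite periodic_Z.
move=> l; rewrite in_cons shiftE; case: eqP => [-> _|_ /= /hy]; last by rewrite Rplus_0_r.
have [b1 b2] := base_Int_part (y j / (2 * PI)); rewrite -/k in b1 b2.
rewrite opp_IZR.
have e : y j = (y j / (2 * PI)) * (2 * PI) by field; lra.
by move: (y j / (2 * PI)) e b1 b2 => q e b1 b2; rewrite e; split; nra.
Qed.

(* The radius d serves both as the size of the neighbourhood and, through 1/d,
   as the bound, so that one application of 1D compactness per coordinate
   suffices. *)
Lemma continuous_bounded_box {n} (u : point n -> C) (s : seq 'I_n) :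
  (forall x, @continuous (fct_UniformSpace 'I_n R_UniformSpace) C_UniformSpace u x) ->
  forall x, exists d : posreal, forall y : point n,
    (forall j, j \notin s -> Rabs (y j - x j) < d) ->
    (forall j, j \in s -> 0 <= y j <= 2 * PI) -> Cmod (u y) <= / d.
Proof.
move=> cu; elim: s => [|j s IH] x.
  have [e He] := proj1 (filterlim_locally u (u x)) (cu x) (mkposreal 1 Rlt_0_1).
  (* Continuity with radius 1 in each of the two components keeps [u y] within 2 of [u x]. *)
  set M := Cmod (u x) + 2.
  have M0 : 0 < M by have := Cmod_ge_0 (u x); rewrite /M; lra.
  have d0 : 0 < Rmin e (/ M) by apply: Rmin_pos; [exact: cond_pos|exact: Rinv_0_lt_compat].
  exists (mkposreal _ d0) => y hy _ /=.
  have hb : ball (u x) 1 (u y).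
    apply: He => l; rewrite /ball /= /AbsRing_ball /abs /minus /plus /opp /=.
    by apply: Rlt_le_trans (hy l isT) _; exact: Rmin_l.
  have [h1 h2] := hb; rewrite /ball /= /AbsRing_ball /abs /minus /plus /opp /= in h1 h2.
  have : Cmod (Cminus (u y) (u x)) <= 2.
    by apply: Rle_trans (Cmod_le_ReIm _) _; rewrite /=; lra.
  have := Cmod_triangle (Cminus (u y) (u x)) (u x).
  rewrite (_ : Cplus (Cminus (u y) (u x)) (u x) = u y); last by ring.
  move=> ? ?; apply: Rle_trans (_ : M <= _); first by rewrite /M; lra.
  rewrite -{1}(Rinv_inv M); apply: Rinv_le_contravar => //; exact: Rmin_r.
have [del Hdel] := functional_choice _ (fun t => IH (update x j t)).
have [d Hd] := compactness_value_1d 0 (2 * PI) del.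
exists d => y hy hb; apply: Rnot_lt_le => lt.
apply: (Hd (y j)); first by apply: hb; rewrite mem_head.
move=> [t [_ [ht dt]]]; apply: (Rlt_not_le _ _ lt).
apply: Rle_trans (_ : / del t <= _); last by apply: Rinv_le_contravar => //; exact: cond_pos.
apply: Hdel => l ls; last by apply: hb; rewrite in_cons ls orbT.
rewrite /update; case: eqP => [->//|/eqP lj].
by apply: Rlt_le_trans (hy l _) dt; rewrite in_cons negb_or lj.
Qed.

Lemma Cinfty_bounded {n} (u : point n -> C) : Cinfty_torus u ->
  exists M, forall x, Cmod (u x) <= M.
Proof.
move=> [pu su].
have [d Hd] := continuous_bounded_box u (enum 'I_n) (fun x => proj1 (su [::] x)) (fun _ => 0).
exists (/ d) => x; have [y [<- hy]] := periodic_box u (enum 'I_n) x pu.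
by apply: Hd => // j; rewrite mem_enum.
Qed.

(** The mean value theorem holds for real functions only, so each component has its own intermediate
    point. *)
Lemma MVT_shift {n} (j : 'I_n) (u : point n -> C) (x : point n) (h : R) : Cinfty_torus u ->
  exists a b : R, [/\ Rabs a <= Rabs h, Rabs b <= Rabs h,
    Re (u (shift x j h)) - Re (u x) = Re (partial j u (shift x j a)) * h &
    Im (u (shift x j h)) - Im (u x) = Im (partial j u (shift x j b)) * h].
Proof.
move=> [pu su].
have D t := ex_partial_derive j u x t (proj2 (su [::] (shift x j t)) j).
have bd c : Rmin 0 h <= c <= Rmax 0 h -> Rabs c <= Rabs h.
  by rewrite /Rmin /Rmax; case: Rle_dec => ? ?; rewrite /Rabs; do 2!case: Rcase_abs; lra.
have cont (g : R -> R) t l : is_derive g t l -> continuity_pt g t.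
  move=> hg; apply/continuity_pt_filterlim.
  by apply: (ex_derive_continuous (V := R_NormedModule)); exists l.
have [a [ha ea]] := MVT_gen _ 0 h _ (fun t _ => proj1 (D t)) (fun t _ => cont _ _ _ (proj1 (D
  t))).
have [b [hb eb]] := MVT_gen _ 0 h _ (fun t _ => proj2 (D t)) (fun t _ => cont _ _ _ (proj2 (D
  t))).
exists a, b; split; [exact: bd|exact: bd| |].
  by move: ea; rewrite shift0 Rminus_0_r.
by move: eb; rewrite shift0 Rminus_0_r.
Qed.

Lemma Cinfty_tame {n} (u : point n -> C) : Cinfty_torus u -> tame u.
Proof.
move=> cu; split; first exact: (proj1 cu).
have [M hM] := Cinfty_bounded u cu.
have [L hL] := fin_all_exists (fun j => Cinfty_bounded _ (Cinfty_partial j u cu)).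
have L0 j : 0 <= L j by apply: Rle_trans (hL j (fun _ => 0)); exact: Cmod_ge_0.
have M0 : 0 <= M by apply: Rle_trans (hM (fun _ => 0)); exact: Cmod_ge_0.
(* A single constant dominating the bound of [u] and, for every direction, twice the bound of the
   partial derivative, once per component. *)
exists (M + 2 * \big[Rplus/0]_j L j); split=> [x|x j h].
  have : 0 <= \big[Rplus/0]_j L j by exact: sum_Rge0.
  by have := hM x; lra.
have [a [b [_ _ ea eb]]] := MVT_shift j u x h cu.
apply: Rle_trans (_ : 2 * L j * Rabs h <= _); last first.
  apply: Rmult_le_compat_r; first exact: Rabs_pos.
  by have := sum_Rge_term _ L j L0; lra.
apply: Rle_trans (Cmod_le_ReIm _) _.
have -> : Re (Cminus (u (shift x j h)) (u x)) = Re (partial j u (shift x j a)) * h by rewrite -ea.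
have -> : Im (Cminus (u (shift x j h)) (u x)) = Im (partial j u (shift x j b)) * h by rewrite -eb.
rewrite !Rabs_mult -Rmult_plus_distr_r; apply: Rmult_le_compat_r; first exact: Rabs_pos.
have := hL j (shift x j a); have := hL j (shift x j b).
have := re_le_Cmod (partial j u (shift x j a)); have := Im_le_Cmod (partial j u (shift x j b));
  lra.
Qed.

(** The mean value theorem puts the derivative at an intermediate point. As [partial j u] is itself
    smooth, hence Lipschitz, moving back to [x] costs at most K |h| in each component. *)
Lemma Cinfty_taylor {n} (j : 'I_n) (u : point n -> C) : Cinfty_torus u ->
  exists K, forall x h, Cmod (Cminus (Cminus (u (shift x j h)) (u x))
    (Cmult (RtoC h) (partial j u x))) <= K * h ^ 2.
Proof.
move=> cu; have [_ [K [_ lK]]] := Cinfty_tame _ (Cinfty_partial j u cu).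
exists (2 * K) => x h; have [a [b [ha hb ea eb]]] := MVT_shift j u x h cu.
apply: Rle_trans (Cmod_le_ReIm _) _.
have h2 : h ^ 2 = Rabs h * Rabs h by rewrite -pow2_abs; ring.
have e1 : Re (Cminus (Cminus (u (shift x j h)) (u x)) (Cmult (RtoC h) (partial j u x)))
   = h * Re (Cminus (partial j u (shift x j a)) (partial j u x)).
  have E : Re (u (shift x j h)) = Re (u x) + Re (partial j u (shift x j a)) * h by lra.
  by rewrite /Re /= in E *; rewrite E; ring.
have e2 : Im (Cminus (Cminus (u (shift x j h)) (u x)) (Cmult (RtoC h) (partial j u x)))
   = h * Im (Cminus (partial j u (shift x j b)) (partial j u x)).
  have E : Im (u (shift x j h)) = Im (u x) + Im (partial j u (shift x j b)) * h by lra.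
  by rewrite /Im /= in E *; rewrite E; ring.
rewrite e1 e2 h2 !Rabs_mult.
have K0 : 0 <= K by have := lK x j 1; rewrite Rabs_R1;
  have := Cmod_ge_0 (Cminus (partial j u (shift x j 1)) (partial j u x)); lra.
have := re_le_Cmod (Cminus (partial j u (shift x j a)) (partial j u x)).
have := Im_le_Cmod (Cminus (partial j u (shift x j b)) (partial j u x)).
have := lK x j a; have := lK x j b; have := Rabs_pos h.
have := Rmult_le_compat_l _ _ _ K0 ha; have := Rmult_le_compat_l _ _ _ K0 hb.
nra.
Qed.

Lemma hat_partial {n} (j : 'I_n) (u : point n -> C) (xi : freq n) : Cinfty_torus u ->
  hat (partial j u) xi = Cmult (Cmult Ci (RtoC (IZR (xi j)))) (hat u xi).
Proof.
move=> cu; have [K hK] := Cinfty_taylor j u cu.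
by apply: (hat_deriv _ _ _ _ K) => //; apply: Cinfty_tame => //; exact: Cinfty_partial.
Qed.

Lemma hat_iter_partial {n} (s : seq 'I_n) (u : point n -> C) (xi : freq n) : Cinfty_torus u ->
  hat (iter_partial s u) xi
  = Cmult (\big[Cmult/RtoC 1]_(j <- s) Cmult Ci (RtoC (IZR (xi j)))) (hat u xi).
Proof.
move=> cu; elim: s => [|j s IH] /=; first by rewrite big_nil Cmult_1_l.
by rewrite hat_partial ?IH ?big_cons ?Cmult_assoc //; exact: Cinfty_iter_partial.
Qed.

(** * Rapidly convergent Fourier series *)

Lemma continuous_point {n} (u : point n -> C) (x : point n) :
  (forall eps : posreal, exists d : posreal, forall y : point n,
     (forall j, Rabs (y j - x j) < d) -> Cmod (Cminus (u y) (u x)) < eps) <->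
  @continuous (fct_UniformSpace 'I_n R_UniformSpace) C_UniformSpace u x.
Proof.
split=> [H|cu eps].
  apply/(filterlim_locally u (u x)) => eps; have [d Hd] := H eps.
  exists d => y hy; have := Hd y hy => h; split.
    by apply: Rle_lt_trans h; exact: (re_le_Cmod (Cminus (u y) (u x))).
  by apply: Rle_lt_trans h; exact: (Im_le_Cmod (Cminus (u y) (u x))).
have e0 : 0 < eps / 2 by apply: Rdiv_lt_0_compat; [exact: cond_pos|lra].
have [d Hd] := proj1 (filterlim_locally u (u x)) cu (mkposreal _ e0).
exists d => y hy; have [h1 h2] := Hd y hy.
apply: Rle_lt_trans (Cmod_le_ReIm _) _.
rewrite /ball /= /AbsRing_ball /abs /minus /plus /opp /= in h1 h2; rewrite /=; lra.
Qed.

Lemma ex_derive_C (f : R -> C) (t : R) :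
  ex_derive (fun s => Re (f s)) t -> ex_derive (fun s => Im (f s)) t ->
  @ex_derive R_AbsRing C_R_NormedModule f t.
Proof.
move=> [a ha] [b hb]; eexists.
apply: (is_derive_ext (V := C_R_NormedModule) (fun s => @plus C_R_NormedModule
   (@scal _ C_R_NormedModule (Re (f s)) (RtoC 1)) (@scal _ C_R_NormedModule (Im (f s)) Ci))).
  by move=> s; apply: Ceq; rewrite /plus /scal /= /plus /scal /= /mult /=; ring.
by apply: is_derive_plus; apply: is_derive_scal_l; eassumption.
Qed.

Lemma is_derive_quadratic (g : R -> R) (t l K : R) :
  (forall h, Rabs (g (t + h) - g t - h * l) <= K * h ^ 2) -> is_derive g t l.
Proof.
move=> H; apply/is_derive_Reals => eps e0.
have K0 : 0 < Rabs K + 1 by have := Rabs_pos K; lra.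
have d0 : 0 < eps / (Rabs K + 1) by exact: Rdiv_lt_0_compat.
exists (mkposreal _ d0) => h h0 /= hd.
have ha : 0 < Rabs h by exact: Rabs_pos_lt.
have -> : (g (t + h) - g t) / h - l = (g (t + h) - g t - h * l) / h by field.
rewrite Rabs_div //; apply/Rlt_div_l => //; apply: Rle_lt_trans (H h) _.
rewrite -(pow2_abs h).
have : (Rabs K + 1) * Rabs h < eps.
  have := Rmult_lt_compat_l _ _ _ K0 hd; rewrite (_ : _ * (_ / _) = eps) //; field; lra.
have := Rle_abs K; nra.
Qed.

(** A quadratic remainder proves differentiability and identifies the derivative at once. For a
    series such remainders can be summed term by term, which takes the place of an exchange of
    limits. *)
Lemma partial_quadratic {n} (j : 'I_n) (u : point n -> C) (x : point n) (l : C) (K : R) :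
  (forall h, Cmod (Cminus (Cminus (u (shift x j h)) (u x)) (Cmult (RtoC h) l)) <= K * h ^ 2) ->
  ex_partial j u x /\ partial j u x = l.
Proof.
move=> H.
have E h : u (update x j (x j + h)) = u (shift x j h) by [].
have E0 : u (update x j (x j)) = u x.
  by congr u; apply: functional_extensionality => k; rewrite /update; case: eqP => [->|].
have d1 : is_derive (fun t => Re (u (update x j t))) (x j) (Re l).
  apply: (is_derive_quadratic _ _ _ K) => h; rewrite E E0; apply: Rle_trans (H h).
  apply: Rle_trans (re_le_Cmod _); apply: Req_le; congr Rabs.
  by rewrite /Re /=; ring.
have d2 : is_derive (fun t => Im (u (update x j t))) (x j) (Im l).
  apply: (is_derive_quadratic _ _ _ K) => h; rewrite E E0; apply: Rle_trans (H h).
  apply: Rle_trans (Im_le_Cmod _); apply: Req_le; congr Rabs.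
  by rewrite /Im /=; ring.
split; first by apply: ex_derive_C; eexists; eassumption.
by rewrite /partial; apply: Ceq => /=; exact: is_derive_unique.
Qed.

(** * Characters of the torus and their orthogonality *)

Definition phase {n} (xi : freq n) (x : point n) : R :=
  \big[Rplus/0]_(j < n) (IZR (xi j) * x j).

Definition char {n} (xi : freq n) (x : point n) : C := cis (phase xi x).

(** Being at least 1, the weight has increasing powers and harmless inverses; being linear in the
    |xi_j|, it allows one factor of [mu] to be traded for first derivatives. *)
Definition mu {n} (xi : freq n) : R := 1 + \big[Rplus/0]_(j < n) Rabs (IZR (xi j)).

Lemma mu_ge1 {n} (xi : freq n) : 1 <= mu xi.
Proof.
have : 0 <= \big[Rplus/0]_(j < n) Rabs (IZR (xi j)) by apply: sum_Rge0 => j _; exact: Rabs_pos.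
by rewrite /mu; lra.
Qed.

Lemma mu_pos {n} (xi : freq n) : 0 < mu xi.
Proof. by have := mu_ge1 xi; lra. Qed.

Lemma mu_coord {n} (xi : freq n) (j : 'I_n) : Rabs (IZR (xi j)) <= mu xi.
Proof.
have h := sum_Rge_term _ (fun j => Rabs (IZR (xi j))) j (fun j => Rabs_pos _).
by apply: Rle_trans h _; rewrite /mu -[X in X <= _]Rplus_0_l; apply: Rplus_le_compat_r; lra.
Qed.

Lemma mu_opp {n} (xi : freq n) : mu (freq_opp xi) = mu xi.
Proof.
by rewrite /mu; congr Rplus; apply: eq_bigr => j _; rewrite /freq_opp opp_IZR Rabs_Ropp.
Qed.

Lemma phase_shift {n} (xi : freq n) (x : point n) (j : 'I_n) (h : R) :
  phase xi (shift x j h) = phase xi x + IZR (xi j) * h.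
Proof.
rewrite /phase (bigD1 j) //= [in RHS](bigD1 j) //= shiftE eqxx.
rewrite (eq_bigr (fun k => IZR (xi k) * x k)) => [|k /negbTE kj]; first by ring.
by rewrite shiftE kj Rplus_0_r.
Qed.

Lemma phase_lip {n} (xi : freq n) (x y : point n) (e : R) : 0 <= e ->
  (forall j, Rabs (x j - y j) <= e) -> Rabs (phase xi x - phase xi y) <= mu xi * e.
Proof.
move=> e0 H.
have -> : phase xi x - phase xi y = \big[Rplus/0]_(j < n) (IZR (xi j) * (x j - y j)).
  rewrite /phase {1}/Rminus (_ : - _ = \big[Rplus/0]_(j < n) (- (IZR (xi j) * y j))).
    by rewrite -big_split /=; apply: eq_bigr => j _; ring.
  by apply: (big_morph Ropp) => [a b|]; ring.
apply: Rle_trans (_ : \big[Rplus/0]_(j < n) (Rabs (IZR (xi j)) * e) <= _).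
  rewrite -Cmod_R (big_morph RtoC (op1 := Cplus) (id1 := RtoC 0)) //; last exact: RtoC_plus.
  apply: Rle_trans (Cmod_sum _ _ _ _) _; apply: sum_Rle => j _.
  by rewrite Cmod_R Rabs_mult; apply: Rmult_le_compat_l => //; exact: Rabs_pos.
rewrite (eq_bigr (fun j => e * Rabs (IZR (xi j)))); last by move=> j _; ring.
by rewrite -sum_Rmult /mu Rmult_plus_distr_r Rmult_1_l (Rmult_comm e) -[X in X <= _]Rplus_0_l;
  apply: Rplus_le_compat_r.
Qed.

Lemma char_shift {n} (xi : freq n) (x : point n) (j : 'I_n) (h : R) :
  char xi (shift x j h) = Cmult (cis (IZR (xi j) * h)) (char xi x).
Proof. by rewrite /char phase_shift cisD Cmult_comm. Qed.

Lemma char_periodic {n} (xi : freq n) : periodic (char xi).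
Proof.
move=> x j; rewrite -/(shift x j (2 * PI)) char_shift -(Rplus_0_l (_ * _)) cis_period cis0.
by rewrite Cmult_1_l.
Qed.

Lemma Cmod_char {n} (xi : freq n) (x : point n) : Cmod (char xi x) = 1.
Proof. exact: Cmod_cis. Qed.

Lemma char_lip {n} (xi : freq n) (x y : point n) (e : R) : 0 <= e ->
  (forall j, Rabs (x j - y j) <= e) -> Cmod (Cminus (char xi x) (char xi y)) <= 2 * (mu xi * e).
Proof.
move=> e0 H; apply: Rle_trans (cis_lip _ _) _.
by apply: Rmult_le_compat_l; [lra|exact: phase_lip].
Qed.

Lemma char_taylor {n} (xi : freq n) (x : point n) (j : 'I_n) (h : R) :
  Cmod (Cminus (Cminus (char xi (shift x j h)) (char xi x))
    (Cmult (RtoC h) (Cmult (Cmult Ci (RtoC (IZR (xi j)))) (char xi x))))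
  <= 2 * mu xi ^ 2 * h ^ 2.
Proof.
rewrite char_shift (_ : Cminus _ _ = Cmult (Cminus (Cminus (cis (IZR (xi j) * h)) (RtoC 1))
  (Cmult Ci (RtoC (IZR (xi j) * h)))) (char xi x)); last by rewrite RtoC_mult; ring.
rewrite Cmod_mult Cmod_char Rmult_1_r; apply: Rle_trans (cis_taylor2 _) _.
rewrite Rpow_mult_distr -(pow2_abs (IZR _)).
have h2 := pow2_ge_0 h; have := mu_coord xi j; have := Rabs_pos (IZR (xi j)) => ? ?.
have : Rabs (IZR (xi j)) ^ 2 <= mu xi ^ 2 by apply: pow_incr.
nra.
Qed.

Lemma char_tame {n} (xi : freq n) : tame (char xi).
Proof.
split; first exact: char_periodic.
exists (2 * mu xi); split=> [x|x j h]; first by rewrite Cmod_char; have := mu_ge1 xi; lra.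
rewrite Rmult_assoc; apply: char_lip; first exact: Rabs_pos.
move=> k; rewrite shiftE (_ : _ - _ = if k == j then h else 0); last by ring.
by case: ifP => _; [exact: Rle_refl|rewrite Rabs_R0; exact: Rabs_pos].
Qed.

Lemma projs_char {n} (xi : freq n) (s : seq 'I_n) : projs xi s (char xi) = char xi.
Proof.
elim: s => //= j s ->; apply: functional_extensionality => x.
rewrite /proj -[RHS]Cavg_const; apply: Cavg_ext => t.
rewrite char_shift -Ropp_mult_distr_l Cmult_comm Cmult_assoc -cisD.
by rewrite Rplus_opp_l cis0 Cmult_1_l.
Qed.

Lemma hat_char {n} (xi : freq n) : hat (char xi) xi = RtoC 1.
Proof.
rewrite /hat projs_char /char /phase big1 ?cis0 // => j _; ring.
Qed.

(** Translation by PI / (xi_j - eta_j) multiplies the coefficient by the phase of [eta], and also by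
    the phase of [xi], which is its negative; so the coefficient vanishes and no integral is
    computed. *)
Lemma hat_char_neq {n} (xi eta : freq n) (j : 'I_n) : xi j <> eta j ->
  hat (char xi) eta = RtoC 0.
Proof.
move=> ne; set a := hat _ _.
set h := PI / IZR (xi j - eta j).
have d0 : IZR (xi j - eta j) <> 0 by apply: not_0_IZR; lia.
have := hat_shift (char xi) eta j h (char_tame xi).
rewrite (_ : (fun x => _) = fun x => Cmult (cis (IZR (xi j) * h)) (char xi x)); last first.
  by apply: functional_extensionality => x; rewrite char_shift.
rewrite hat_scal; last exact: char_tame.
rewrite -/a (_ : IZR (xi j) * h = IZR (eta j) * h + PI); last first.
  rewrite /h minus_IZR; field; by rewrite -minus_IZR.
rewrite cisD (_ : cis PI = RtoC (-1)); last by rewrite /cis cos_PI sin_PI.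
set c := cis _ => e.
have : Cmult c a = RtoC 0.
  have -> : Cmult c a = Cmult (RtoC (/ 2)) (Cminus (Cmult c a) (Cmult (Cmult c (RtoC (-1))) a)).
    by apply: Ceq => /=; field.
  by rewrite e; ring.
move=> /(f_equal Cmod); rewrite Cmod_mult Cmod_cis Rmult_1_l Cmod_0; exact: Cmod_eq_0.
Qed.

(** * Absolutely convergent series and the smooth functions they define *)

Definition abs_summable (z : nat -> C) : Prop := ex_series (fun k => Cmod (z k)).

Definition CSeries (z : nat -> C) : C :=
  (Series (fun k => Re (z k)), Series (fun k => Im (z k))).

Lemma ex_series_dominated (a b : nat -> R) : (forall k, Rabs (a k) <= b k) ->
  ex_series b -> ex_series a.
Proof. exact: (ex_series_le (V := R_CompleteNormedModule)). Qed.

Lemma abs_summable_Re (z : nat -> C) : abs_summable z -> ex_series (fun k => Re (z k)).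
Proof. by apply: ex_series_dominated => k; exact: re_le_Cmod. Qed.

Lemma abs_summable_Im (z : nat -> C) : abs_summable z -> ex_series (fun k => Im (z k)).
Proof. by apply: ex_series_dominated => k; exact: Im_le_Cmod. Qed.

Lemma CSeries_bound (z : nat -> C) (b : nat -> R) : (forall k, Cmod (z k) <= b k) ->
  ex_series b -> Cmod (CSeries z) <= 2 * Series b.
Proof.
move=> zb eb.
have H (g : nat -> R) : (forall k, Rabs (g k) <= b k) -> Rabs (Series g) <= Series b.
  move=> gb; apply: Rle_trans (Series_Rabs _ _) _.
    by apply: (ex_series_dominated _ b) => // k; rewrite Rabs_Rabsolu.
  by apply: Series_le => // k; split=> //; exact: Rabs_pos.
have h1 := H _ (fun k => Rle_trans _ _ _ (re_le_Cmod (z k)) (zb k)).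
have h2 := H _ (fun k => Rle_trans _ _ _ (Im_le_Cmod (z k)) (zb k)).
by apply: Rle_trans (Cmod_le_ReIm _) _; rewrite /= in h1 h2 *; lra.
Qed.

Lemma CSeries_ext (z w : nat -> C) : (forall k, z k = w k) -> CSeries z = CSeries w.
Proof. by move=> e; rewrite (functional_extensionality _ _ e). Qed.

Lemma CSeries_minus (z w : nat -> C) : abs_summable z -> abs_summable w ->
  CSeries (fun k => Cminus (z k) (w k)) = Cminus (CSeries z) (CSeries w).
Proof.
move=> hz hw; apply: Ceq => /=.
  by rewrite Series_minus //; exact: abs_summable_Re.
by rewrite Series_minus //; exact: abs_summable_Im.
Qed.

Lemma CSeries_Rscal (a : R) (z : nat -> C) :
  CSeries (fun k => Cmult (RtoC a) (z k)) = Cmult (RtoC a) (CSeries z).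
Proof.
apply: Ceq => /=; rewrite !Rmult_0_l ?Rminus_0_r ?Rplus_0_r -Series_scal_l;
  apply: Series_ext => k;
  rewrite /Re /Im; ring.
Qed.

Lemma CSeries_incr_1 (z : nat -> C) : abs_summable z ->
  CSeries z = Cplus (z 0%N) (CSeries (fun k => z k.+1)).
Proof.
move=> hz; apply: Ceq => /=; rewrite Series_incr_1 //;
  [exact: abs_summable_Re|exact: abs_summable_Im].
Qed.

Lemma abs_summable_minus (z w : nat -> C) : abs_summable z -> abs_summable w ->
  abs_summable (fun k => Cminus (z k) (w k)).
Proof.
move=> hz hw; apply: (ex_series_dominated _ (fun k => Cmod (z k) + Cmod (w k))).
  move=> k; rewrite Rabs_pos_eq; last exact: Cmod_ge_0.
  by have := Cmod_triangle (z k) (Copp (w k)); rewrite Cmod_opp.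
exact: (ex_series_plus (V := R_NormedModule)).
Qed.

(** The frequencies need be neither distinct nor exhaustive, so sparse data, a single character and
    a full enumeration of the lattice are all covered. *)
Definition rapid {n} (a : nat -> C) (xi : nat -> freq n) : Prop :=
  forall N : nat, ex_series (fun k => Cmod (a k) * mu (xi k) ^ N).

Definition fseries {n} (a : nat -> C) (xi : nat -> freq n) (x : point n) : C :=
  CSeries (fun k => Cmult (a k) (char (xi k) x)).

Lemma rapid_summable {n} (a : nat -> C) (xi : nat -> freq n) (x : point n) : rapid a xi ->
  abs_summable (fun k => Cmult (a k) (char (xi k) x)).
Proof.
move=> ra; apply: (ex_series_dominated _ _ _ (ra 0%N)) => k.
rewrite Rabs_pos_eq; last exact: Cmod_ge_0.
by rewrite Cmod_mult Cmod_char /=; lra.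
Qed.

Lemma rapid_partial {n} (a : nat -> C) (xi : nat -> freq n) (j : 'I_n) : rapid a xi ->
  rapid (fun k => Cmult (Cmult Ci (RtoC (IZR (xi k j)))) (a k)) xi.
Proof.
move=> ra N; apply: (ex_series_dominated _ _ _ (ra N.+1)) => k.
rewrite 2!Cmod_mult Cmod_Ci Cmod_R Rmult_1_l.
have m0 := mu_pos (xi k); have mN : 0 < mu (xi k) ^ N by exact: pow_lt.
have a0 := Cmod_ge_0 (a k); have := mu_coord (xi k) j; have z0 := Rabs_pos (IZR (xi k j)) => zm.
rewrite Rabs_pos_eq; last first.
  by apply: Rmult_le_pos; [exact: Rmult_le_pos|exact: Rlt_le].
rewrite (_ : _ * mu (xi k) ^ N.+1 = mu (xi k) * Cmod (a k) * mu (xi k) ^ N);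
  last by rewrite /=; ring.
by apply: Rmult_le_compat_r; [exact: Rlt_le|apply: Rmult_le_compat_r].
Qed.

(** The remainders of the characters are summed; 4 is the 2 of [char_taylor] times the 2 of
    [CSeries_bound]. *)
Lemma fseries_taylor {n} (a : nat -> C) (xi : nat -> freq n) (x : point n) (j : 'I_n) (h : R) :
  rapid a xi ->
  Cmod (Cminus (Cminus (fseries a xi (shift x j h)) (fseries a xi x))
    (Cmult (RtoC h) (fseries (fun k => Cmult (Cmult Ci (RtoC (IZR (xi k j)))) (a k)) xi x)))
  <= (4 * Series (fun k => Cmod (a k) * mu (xi k) ^ 2)) * h ^ 2.
Proof.
move=> ra; have rb := rapid_partial _ _ j ra.
rewrite /fseries -CSeries_Rscal -CSeries_minus; try exact: rapid_summable.
have hs : abs_summable (fun k => Cmult (RtoC h)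
    (Cmult (Cmult (Cmult Ci (RtoC (IZR (xi k j)))) (a k)) (char (xi k) x))).
  have [l hl] := rapid_summable _ _ x rb; exists (Rabs h * l).
  apply: (is_series_ext (fun k => Rabs h * Cmod (Cmult (Cmult (Cmult Ci (RtoC (IZR (xi k j))))
    (a k)) (char (xi k) x)))).
    by move=> k; rewrite [in RHS]Cmod_mult Cmod_R.
  exact: (is_series_scal_l (V := R_NormedModule)).
rewrite -CSeries_minus //; last by apply: abs_summable_minus; exact: rapid_summable.
have -> : 4 * Series (fun k => Cmod (a k) * mu (xi k) ^ 2) * h ^ 2
   = 2 * Series (fun k => (2 * h ^ 2) * (Cmod (a k) * mu (xi k) ^ 2)).
  by rewrite Series_scal_l; ring.
apply: CSeries_bound; last by apply: (ex_series_scal_l (V := R_NormedModule)); exact: ra.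
move=> k.
rewrite (_ : Cminus _ _ = Cmult (a k) (Cminus (Cminus (char (xi k) (shift x j h)) (char (xi k) x))
    (Cmult (RtoC h) (Cmult (Cmult Ci (RtoC (IZR (xi k j)))) (char (xi k) x))))); last by ring.
rewrite Cmod_mult.
have := Rmult_le_compat_l _ _ _ (Cmod_ge_0 (a k)) (char_taylor (xi k) x j h); lra.
Qed.

Lemma fseries_continuous {n} (a : nat -> C) (xi : nat -> freq n) (x : point n) : rapid a xi ->
  @continuous (fct_UniformSpace 'I_n R_UniformSpace) C_UniformSpace (fseries a xi) x.
Proof.
move=> ra; apply/continuous_point => eps.
set S := Series (fun k => Cmod (a k) * mu (xi k) ^ 1).
have S0 : 0 <= S.
  have <- : Series (fun _ => 0 * 0) = 0 by rewrite Series_scal_l; ring.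
  apply: Series_le => [k|]; last exact: ra.
  have := Cmod_ge_0 (a k); have := mu_pos (xi k); rewrite pow_1; split; nra.
(* The 4 S is the Lipschitz constant of the series; the added 1 covers S = 0 and makes the final
   inequality strict. *)
have d0 : 0 < eps / (4 * S + 1) by apply: Rdiv_lt_0_compat; [exact: cond_pos|lra].
exists (mkposreal _ d0) => y /= hy.
rewrite /fseries -CSeries_minus; try exact: rapid_summable.
apply: Rle_lt_trans (_ : 2 * Series (fun k => (2 * (eps / (4 * S + 1))) * (Cmod (a k) * mu (xi
  k) ^ 1)) < _).
  apply: CSeries_bound; last by apply: (ex_series_scal_l (V := R_NormedModule)); exact: ra.
  move=> k; rewrite (_ : Cminus _ _ = Cmult (a k) (Cminus (char (xi k) y) (char (xi k) x)));
    last by ring.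
  have := char_lip (xi k) y x _ (Rlt_le _ _ d0) (fun j => Rlt_le _ _ (hy j)).
  move=> /(Rmult_le_compat_l _ _ _ (Cmod_ge_0 (a k))); rewrite Cmod_mult /=; lra.
rewrite Series_scal_l -/S.
rewrite (_ : 2 * _ = (4 * S) * (eps / (4 * S + 1))); last by field; lra.
have := cond_pos eps => e0.
have -> : 4 * S * (eps / (4 * S + 1)) = eps - eps / (4 * S + 1) by field; lra.
lra.
Qed.

Lemma partial_fseries {n} (a : nat -> C) (xi : nat -> freq n) (j : 'I_n) : rapid a xi ->
  partial j (fseries a xi) = fseries (fun k => Cmult (Cmult Ci (RtoC (IZR (xi k j)))) (a k)) xi.
Proof.
move=> ra; apply: functional_extensionality => x.
by have [_] := partial_quadratic j _ x _ _ (fun h => fseries_taylor a xi x j h ra).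
Qed.

(** Differentiation multiplies the coefficients by i xi_j and preserves rapid decay, so every
    iterated derivative is again such a series. *)
Lemma fseries_Cinfty {n} (a : nat -> C) (xi : nat -> freq n) : rapid a xi ->
  Cinfty_torus (fseries a xi).
Proof.
move=> ra; split.
  by move=> x j; apply: CSeries_ext => k; rewrite char_periodic.
move=> s x.
have [b [rb ->]] : exists b, rapid b xi /\ iter_partial s (fseries a xi) = fseries b xi.
  elim: s => [|j s [b [rb IH]]]; first by exists a.
  exists (fun k => Cmult (Cmult Ci (RtoC (IZR (xi k j)))) (b k)).
  by split; [exact: rapid_partial|rewrite /= IH partial_fseries].
split; first exact: fseries_continuous.
move=> j.
by have [] := partial_quadratic j _ x _ _ (fun h => fseries_taylor b xi x j h rb).
Qed.

Lemma rapid_incr {n} (a : nat -> C) (xi : nat -> freq n) : rapid a xi ->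
  rapid (fun k => a k.+1) (fun k => xi k.+1).
Proof.
move=> ra N.
exact: (proj1 (ex_series_incr_1 (V := R_NormedModule) (fun k => Cmod (a k) * mu (xi k) ^ N))
  (ra N)).
Qed.

Lemma Series_tail (b : nat -> R) (K : nat) : ex_series b ->
  Series b = \big[Rplus/0]_(k < K) b k + Series (fun k => b (K + k)%N).
Proof.
elim: K b => [|K IH] b eb; first by rewrite big_ord0 Rplus_0_l.
rewrite Series_incr_1 // big_ord_recl /= Rplus_assoc; congr Rplus.
by rewrite (IH (fun k => b k.+1)) //; exact: (proj1 (ex_series_incr_1 (V := R_NormedModule) b)).
Qed.

Lemma Series_tail_small (b : nat -> R) (eps : R) : ex_series b -> 0 < eps ->
  exists K0, forall K, (K0 <= K)%N -> Rabs (Series (fun k => b (K + k)%N)) < eps.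
Proof.
move=> eb e0.
have h := Series_correct _ eb; move/is_series_Reals: h => /(_ _ e0) [K0 H].
exists K0.+1 => -[//|K] hK.
have := H K ltac:(apply/leP; exact: hK); rewrite /R_dist.
have -> : sum_f_R0 b K = \big[Rplus/0]_(k < K.+1) b k.
  by elim: K {hK} => [|K IH]; rewrite big_ord_recr /= ?big_ord0 ?Rplus_0_l // IH.
rewrite {1}(Series_tail b K.+1 eb) => h; rewrite -Rabs_Ropp; apply: Rle_lt_trans h.
by apply: Req_le; congr Rabs; ring.
Qed.

Lemma hat_fseries_incr {n} (a : nat -> C) (xi : nat -> freq n) (eta : freq n) (K : nat) :
  rapid a xi ->
  hat (fseries a xi) eta = Cplus
    (\big[Cplus/RtoC 0]_(k < K) Cmult (a k) (hat (char (xi k)) eta))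
    (hat (fseries (fun k => a (K + k)%N) (fun k => xi (K + k)%N)) eta).
Proof.
elim: K a xi => [|K IH] a xi ra; first by rewrite big_ord0 Cplus_0_l.
rewrite big_ord_recl /= -Cplus_assoc.
rewrite -(IH (fun k => a k.+1) (fun k => xi k.+1)); last exact: rapid_incr.
rewrite -hat_scal; last exact: char_tame.
rewrite -hat_plus; last 2 first.
- by apply: tame_scal; exact: char_tame.
- by apply: Cinfty_tame; apply: fseries_Cinfty; exact: rapid_incr.
congr hat; apply: functional_extensionality => x.
by rewrite {1}/fseries CSeries_incr_1 //; exact: rapid_summable.
Qed.

(** Linearity is applied to finitely many terms only. The coefficient of the remainder is bounded by
    its sup norm, a tail of a convergent series, while the finite sums are constant from [K0] on. *)
Lemma hat_fseries {n} (a : nat -> C) (xi : nat -> freq n) (eta : freq n) (K0 : nat) :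
  rapid a xi ->
  (forall k, (K0 <= k)%N -> Cmult (a k) (hat (char (xi k)) eta) = RtoC 0) ->
  hat (fseries a xi) eta
  = \big[Cplus/RtoC 0]_(k < K0) Cmult (a k) (hat (char (xi k)) eta).
Proof.
move=> ra H0.
set S := \big[_/_]_(k < K0) _.
have fin K : (K0 <= K)%N -> \big[Cplus/RtoC 0]_(k < K) Cmult (a k) (hat (char (xi k)) eta) = S.
  move=> le; rewrite -(subnK le) addnC; elim: (K - K0)%N => [|m IH]; first by rewrite addn0.
  rewrite addnS big_ord_recr /= IH H0 ?leq_addr //; ring.
suff z : Cmod (Cminus (hat (fseries a xi) eta) S) = 0.
  have := Cmod_eq_0 _ z => e.
  by rewrite (_ : hat _ _ = Cplus (Cminus (hat (fseries a xi) eta) S) S); [rewrite e; ring|ring].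
apply: Rle_antisym; last exact: Cmod_ge_0.
apply: le_epsilon => e e0; rewrite Rplus_0_l.
(* The factor 2 ^ n is lost in [hat_bound], the factor 2 in [CSeries_bound]. *)
have p0 : 0 < 2 ^ n * 2 by apply: Rmult_lt_0_compat; [apply: pow_lt|]; lra.
have [K1 HK] := Series_tail_small _ (e / (2 ^ n * 2)) (ra 0%N) (Rdiv_lt_0_compat _ _ e0 p0).
set K := maxn K0 K1.
have rK : rapid (fun k => a (K + k)%N) (fun k => xi (K + k)%N).
  by move=> N; exact: (proj1 (ex_series_incr_n (V := R_NormedModule) _ K) (ra N)).
rewrite (hat_fseries_incr _ _ _ K ra) fin ?leq_maxl //.
rewrite (_ : Cminus _ _ = hat (fseries (fun k => a (K + k)%N) (fun k => xi (K + k)%N)) eta);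
  last by ring.
have b x : Cmod (fseries (fun k => a (K + k)%N) (fun k => xi (K + k)%N) x)
    <= 2 * Series (fun k => Cmod (a (K + k)%N) * mu (xi (K + k)%N) ^ 0).
  apply: CSeries_bound; last exact: (rK 0%N).
  by move=> k; rewrite Cmod_mult Cmod_char /=; lra.
apply: Rle_trans (hat_bound _ eta _ (Cinfty_tame _ (fseries_Cinfty _ _ rK)) b) _.
have := HK K (leq_maxr _ _); set T := Series _ => hT.
have {hT} : T <= e / (2 ^ n * 2) by apply: Rle_trans (Rle_abs T) _; exact: Rlt_le.
move=> /(Rmult_le_compat_l (2 ^ n * 2) _ _ (Rlt_le _ _ p0)).
rewrite (_ : _ * (e / _) = e); [lra|by field; lra].
Qed.

Lemma hat_fseries_single {n} (a : nat -> C) (xi : nat -> freq n) (eta : freq n) (t : nat) :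
  rapid a xi ->
  (forall k, k <> t -> Cmult (a k) (hat (char (xi k)) eta) = RtoC 0) ->
  hat (fseries a xi) eta = Cmult (a t) (hat (char (xi t)) eta).
Proof.
move=> ra H; rewrite (hat_fseries _ _ eta t.+1) //; last first.
  by move=> k tk; apply: H => e; rewrite e ltnn in tk.
rewrite big_ord_recr /= big1 => [|k _]; first by rewrite Cplus_0_l.
by apply: H => e; have := ltn_ord k; rewrite e ltnn.
Qed.

Lemma hat_char_neq_freq {n} (xi eta : freq n) : xi <> eta -> hat (char xi) eta = RtoC 0.
Proof.
move=> ne; have [j hj] : exists j, xi j <> eta j.
  apply: not_all_not_ex => H; apply: ne; apply: functional_extensionality => j.
  exact: NNPP.
exact: hat_char_neq hj.
Qed.

(** * The symbol, decay and synthesis *)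

Lemma freq_oppK {n} (xi : freq n) : freq_opp (freq_opp xi) = xi.
Proof. by apply: functional_extensionality => j; exact: Z.opp_involutive. Qed.

Lemma word_symbol {n} (xi : freq n) (alpha : multi_index n) :
  \big[Cmult/RtoC 1]_(j <- word alpha) Cmult Ci (RtoC (IZR (xi j)))
  = Cmult (Cpow Ci (mdeg alpha)) (RtoC (monomial xi alpha)).
Proof.
rewrite /word /mdeg /monomial -!big_enum /=.
(* The enumeration is forgotten so that the induction can run over an arbitrary list of
   coordinates. *)
have [r ->] : exists r : seq 'I_n, enum 'I_n = r by exists (enum 'I_n).
elim: r => [|j r IH] /=; first by rewrite !big_nil /= Cmult_1_r.
rewrite big_cat /= IH !big_cons.
have -> : \big[Cmult/RtoC 1]_(i <- nseq (alpha j) j) Cmult Ci (RtoC (IZR (xi i)))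
   = Cmult (Cpow Ci (alpha j)) (RtoC (IZR (xi j) ^ alpha j)).
  elim: (alpha j) => [|k IHk]; first by rewrite big_nil /= Cmult_1_r.
  by rewrite /= big_cons IHk RtoC_mult; ring.
rewrite (_ : (alpha j + _)%N = (alpha j + \sum_(i <- r) alpha i)%coq_nat) // Cpow_add_r RtoC_mult.
ring.
Qed.

Lemma hat_mpartial {n} (alpha : multi_index n) (u : point n ->
  C) (xi : freq n) : Cinfty_torus u ->
  hat (mpartial alpha u) xi
  = Cmult (Cmult (Cpow Ci (mdeg alpha)) (RtoC (monomial xi alpha))) (hat u xi).
Proof. by move=> cu; rewrite /mpartial hat_iter_partial // word_symbol. Qed.

Lemma mpartial_tame {n} (alpha : multi_index n) (u : point n -> C) :
  Cinfty_torus u -> tame (mpartial alpha u).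
Proof. by move=> cu; apply: Cinfty_tame; exact: Cinfty_iter_partial. Qed.

Lemma diff_op_tame {n} (m : nat) (c : multi_index n -> C) (u : point n -> C) :
  Cinfty_torus u -> tame (diff_op m c u).
Proof.
by move=> cu; apply: tame_sum => a; apply: tame_scal; exact: mpartial_tame.
Qed.

Lemma hat_diff_op {n} (m : nat) (c : multi_index n -> C) (u : point n -> C) (xi : freq n) :
  Cinfty_torus u -> hat (diff_op m c u) xi = Cmult (symbol m c xi) (hat u xi).
Proof.
move=> cu; rewrite /diff_op /symbol /sum_mi hat_sum; last first.
  by move=> a; apply: tame_scal; exact: mpartial_tame.
rewrite Cmult_comm sum_Cmult; apply: eq_bigr => a _.
rewrite hat_scal; last exact: mpartial_tame.
by rewrite hat_mpartial //; ring.
Qed.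

Lemma vekua_tame {n} (m : nat) (c : multi_index n -> C) (A B : C) (u : point n -> C) :
  Cinfty_torus u -> tame (vekua m c A B u).
Proof.
move=> cu; have tu := Cinfty_tame u cu.
by apply: tame_minus; [apply: tame_minus;
  [exact: diff_op_tame|exact: tame_scal]|apply: tame_scal; exact: tame_conj].
Qed.

Lemma hat_vekua {n} (m : nat) (c : multi_index n -> C) (A B : C) (u : point n ->
  C) (xi : freq n) :
  Cinfty_torus u ->
  hat (vekua m c A B u) xi
  = ((symbol m c xi - A) * hat u xi - B * Cconj (hat u (freq_opp xi)))%C.
Proof.
move=> cu; have tu := Cinfty_tame u cu; have tc := tame_conj u tu.
have tL := diff_op_tame m c u cu.
rewrite /vekua hat_minus; [|by apply: tame_minus => //; exact: tame_scal|exact: tame_scal].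
rewrite hat_minus //; last exact: tame_scal.
by rewrite !hat_scal // hat_diff_op // hat_conj //; ring.
Qed.

(** One more factor [mu] splits as 1 + sum of |xi_j|, and |xi_j| times the coefficient of [f] is the
    modulus of that of [partial j f], to which the induction hypothesis applies. *)
Lemma Cinfty_hat_decay {n} (N : nat) (f : point n -> C) : Cinfty_torus f ->
  exists K, forall xi, mu xi ^ N * Cmod (hat f xi) <= K.
Proof.
elim: N f => [|N IH] f cf.
  have [M hM] := Cinfty_bounded f cf.
  by exists (2 ^ n * M) => xi; rewrite Rmult_1_l; apply: hat_bound => //; exact: Cinfty_tame.
have [K hK] := IH f cf.
have [L hL] := fin_all_exists (fun j => IH _ (Cinfty_partial j f cf)).
exists (K + \big[Rplus/0]_j L j) => xi.
rewrite /= {1}/mu !Rmult_plus_distr_r Rmult_1_l; apply: Rplus_le_compat; first exact: hK.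
rewrite Rmult_assoc Rmult_comm sum_Rmult; apply: sum_Rle => j _.
have := hL j xi; rewrite hat_partial // 2!Cmod_mult Cmod_Ci Cmod_R; lra.
Qed.

Lemma monomial_bound {n} (xi : freq n) (alpha : multi_index n) :
  Rabs (monomial xi alpha) <= mu xi ^ mdeg alpha.
Proof.
apply: (big_ind2 (fun a k => Rabs a <= mu xi ^ k)) => [|a k b l ha hb|j _].
- by rewrite Rabs_R1; exact: Rle_refl.
- rewrite Rabs_mult (_ : (k + l)%N = (k + l)%coq_nat) // pow_add.
  by apply: Rmult_le_compat => //; exact: Rabs_pos.
- rewrite -RPow_abs; apply: pow_incr; split; [exact: Rabs_pos|exact: mu_coord].
Qed.

Lemma mu_pow_mono {n} (xi : freq n) (k l : nat) : (k <= l)%N -> mu xi ^ k <= mu xi ^ l.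
Proof. by move=> kl; apply: Rle_pow; [exact: mu_ge1|apply/leP]. Qed.

Lemma symbol_bound {n} (m : nat) (c : multi_index n -> C) :
  exists K, 0 <= K /\ forall xi, Cmod (symbol m c xi) <= K * mu xi ^ m.
Proof.
rewrite /symbol /sum_mi.
set S := \big[Rplus/0]_(a : {ffun 'I_n -> 'I_m.+1} | (0 < mdeg (fun j => a j) <= m)%N)
   Cmod (c (fun j => nat_of_ord (a j))).
exists S; split; first by apply: sum_Rge0 => a _; exact: Cmod_ge_0.
move=> xi; apply: Rle_trans (Cmod_sum _ _ _ _) _.
rewrite Rmult_comm sum_Rmult; apply: sum_Rle => a /andP[_ am].
rewrite 2!Cmod_mult Cmod_pow Cmod_Ci pow1 Rmult_1_l Cmod_R Rmult_comm.
apply: Rmult_le_compat_r; first exact: Cmod_ge_0.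
by apply: Rle_trans (monomial_bound _ _) _; exact: mu_pow_mono.
Qed.

(** * Enumeration of the lattice, with a summable weight *)

Definition zenc (z : Z) : nat := Z.to_nat (if (z <? 0)%Z then - 2 * z - 1 else 2 * z)%Z.

Definition zdec (m : nat) : Z :=
  let k := Z.of_nat m in
  if (k mod 2 =? 0)%Z then (k / 2)%Z else (- ((k + 1) / 2))%Z.

Lemma zencK (z : Z) : zdec (zenc z) = z.
Proof.
rewrite /zdec /zenc.
case: (Z.ltb_spec z 0) => h; rewrite Z2Nat.id; try lia;
  by case: Z.eqb_spec => h'; Z.to_euclidean_division_equations; lia.
Qed.

Lemma zdecK (m : nat) : zenc (zdec m) = m.
Proof.
rewrite /zdec /zenc; case: Z.eqb_spec => h; case: Z.ltb_spec => h';
  Z.to_euclidean_division_equations; lia.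
Qed.

(** Linear growth of this zigzag bijection is what allows weights in the codes to be bounded by
    powers of [mu]. *)
Lemma zenc_bound (z : Z) : INR (zenc z) <= 2 * Rabs (IZR z).
Proof.
rewrite /zenc -abs_IZR -mult_IZR INR_IZR_INZ; apply: IZR_le.
case: (Z.ltb_spec z 0) => h; rewrite Z2Nat.id; lia.
Qed.

(** Finite functions into [nat] form a countable type with [pickle]; frequencies, being plain
    functions, are enumerated through it. *)
Definition freq_of {n} (alpha : {ffun 'I_n -> nat}) : freq n := fun j => zdec (alpha j).

Definition code {n} (xi : freq n) : {ffun 'I_n -> nat} := [ffun j => zenc (xi j)].

Lemma codeK {n} (xi : freq n) : freq_of (code xi) = xi.
Proof. by apply: functional_extensionality => j; rewrite /freq_of ffunE zencK. Qed.

Lemma freq_ofK {n} (alpha : {ffun 'I_n -> nat}) : code (freq_of alpha) = alpha.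
Proof. by apply/ffunP => j; rewrite ffunE /freq_of zdecK. Qed.

(** The stronger bound 2 - 1/(r+1) for r+1 terms telescopes, because 1/(r+2)^2 <= 1/((r+1)(r+2)). *)
Lemma sum_inv_sqr (r : nat) : \big[Rplus/0]_(k < r) / (INR k + 1) ^ 2 <= 2.
Proof.
case: r => [|r]; first by rewrite big_ord0; lra.
suff : \big[Rplus/0]_(k < r.+1) / (INR k + 1) ^ 2 <= 2 - / (INR r + 1).
  have : 0 < / (INR r + 1) by apply: Rinv_0_lt_compat; have := pos_INR r; lra.
  lra.
have step (F : nat -> R) k : \big[Rplus/0]_(i < k.+1) F i = \big[Rplus/0]_(i < k) F i + F k.
  by rewrite big_ord_recr.
elim: r => [|r IH]; first by rewrite (step (fun k => / (INR k + 1) ^ 2) 0%N) big_ord0 /=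
  !Rplus_0_l !Rmult_1_r Rinv_1; lra.
rewrite (step (fun k => / (INR k + 1) ^ 2)); move: IH.
set T := bigop _ _ _ => IH; rewrite S_INR.
have p := pos_INR r; set q := INR r in p IH *.
apply: Rle_trans (Rplus_le_compat_r _ _ _ IH) _.
have -> : 2 - / (q + 1 + 1) = 2 - / (q + 1) + / ((q + 1) * (q + 1 + 1)) by field; lra.
by apply: Rplus_le_compat_l; apply: Rinv_le_contravar; nra.
Qed.

(** A product of one-dimensional summable weights, hence summable over all codes, yet bounded below
    by a negative power of [mu], so that rapid decay beats it. *)
Definition box_weight {n} (alpha : {ffun 'I_n -> nat}) : R :=
  \big[Rmult/1]_j / (INR (alpha j) + 1) ^ 2.

Lemma box_weight_pos {n} (alpha : {ffun 'I_n -> nat}) : 0 < box_weight alpha.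
Proof.
apply: (big_ind (fun r => 0 < r)) => [|a b|j _]; [lra|exact: Rmult_lt_0_compat|].
by apply/Rinv_0_lt_compat/pow_lt; have := pos_INR (alpha j); lra.
Qed.

Lemma box_weight_mu {n} (xi : freq n) : / box_weight (code xi) <= (4 * mu xi ^ 2) ^ n.
Proof.
have -> : (4 * mu xi ^ 2) ^ n = \big[Rmult/1]_(j < n) (4 * mu xi ^ 2).
  by rewrite prod_Rconst.
have H : 0 < box_weight (code xi) /\ / box_weight (code xi)
  <= \big[Rmult/1]_(j < n) (4 * mu xi ^ 2).
  rewrite /box_weight.
  apply: (big_ind2 (fun a b => 0 < a /\ / a <= b)) => [|a b a' b' [a0 ab] [a0' ab']|j _].
  - by rewrite Rinv_1; lra.
  - split; first exact: Rmult_lt_0_compat.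
    rewrite Rinv_mult; apply: Rmult_le_compat => //; apply: Rlt_le; exact: Rinv_0_lt_compat.
  rewrite ffunE; have p := pos_INR (zenc (xi j)); split.
    by apply/Rinv_0_lt_compat/pow_lt; lra.
  rewrite Rinv_inv (_ : 4 * mu xi ^ 2 = (2 * mu xi) ^ 2); last by ring.
  apply: pow_incr; split; first by lra.
  have := zenc_bound (xi j).
  have h := sum_Rge_term _ (fun j => Rabs (IZR (xi j))) j (fun j => Rabs_pos _).
  have : 1 + Rabs (IZR (xi j)) <= mu xi by rewrite /mu; apply: Rplus_le_compat_l.
  lra.
exact: proj2 H.
Qed.

Lemma ex_series_bounded (b : nat -> R) (M : R) : (forall k, 0 <= b k) ->
  (forall K, \big[Rplus/0]_(k < K) b k <= M) -> ex_series b.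
Proof.
move=> b0 bM.
have E K : sum_n b K = \big[Rplus/0]_(k < K.+1) b k.
  elim: K => [|K IH]; first by rewrite sum_O big_ord_recr big_ord0 /= Rplus_0_l.
  by rewrite sum_Sn IH [in RHS]big_ord_recr.
have [l hl] : ex_finite_lim_seq (sum_n b).
  apply: (ex_finite_lim_seq_incr _ M) => K; last by rewrite E.
  by rewrite sum_Sn /plus /=; have := b0 K.+1; lra.
by exists l.
Qed.

(** Some natural numbers may encode nothing; weights and coefficients take the default 0 there, so
    the gaps contribute nothing to a series. *)
Definition at_index {n} {T : Type} (d : T) (w : {ffun 'I_n -> nat} -> T) (k : nat) : T :=
  if @pickle_inv {ffun 'I_n -> nat} k is Some alpha then w alpha else d.

Lemma box_weight_summable {n} : ex_series (at_index 0 (@box_weight n)).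
Proof.
have w0 k : 0 <= at_index 0 (@box_weight n) k.
  by rewrite /at_index; case: pickle_inv => [a|]; [apply: Rlt_le; exact: box_weight_pos|lra].
apply: (ex_series_bounded _ (2 ^ n)) => // K.
(* The finitely many codes met below K all lie in one cube of side r. *)
have [r Hr] : exists r, forall k (alpha : {ffun 'I_n -> nat}), (k < K)%N ->
    pickle_inv k = Some alpha -> forall j, (alpha j <= r)%N.
  elim: K => [|K [r Hr]]; first by exists 0%N.
  case E : (@pickle_inv {ffun 'I_n -> nat} K) => [a|]; last first.
    exists r => k alpha; rewrite ltnS leq_eqVlt => /orP[/eqP ->|]; first by rewrite E.
    exact: Hr.
  exists (r + \sum_j a j)%N => k alpha; rewrite ltnS leq_eqVlt => /orP[/eqP ->|kK e j].
    by rewrite E => -[<-] j; rewrite (bigD1 j) //= addnCA leq_addr.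
  by apply: leq_trans (leq_addr _ _); exact: (Hr k).
pose g (b : {ffun 'I_n -> 'I_r.+1}) : {ffun 'I_n -> nat} := [ffun j => nat_of_ord (b j)].
have -> : 2 ^ n = \big[Rmult/1]_(j < n) 2.
  by rewrite prod_Rconst.
apply: Rle_trans (_ : \big[Rplus/0]_b box_weight (g b) <= _); last first.
  rewrite (eq_bigr (fun b : {ffun 'I_n -> 'I_r.+1} => \big[Rmult/1]_j / (INR (b j) + 1) ^ 2));
    last first.
    by move=> b _; apply: eq_bigr => j _; rewrite ffunE.
  (* Over a cube the sum of products is a product of n one-dimensional sums, each at most 2. *)
  rewrite -(bigA_distr_bigA (fun (j : 'I_n) (i : 'I_r.+1) => / (INR i + 1) ^ 2)).
  apply: (proj2 (_ : 0 <= _ /\ _)).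
  apply: (big_ind2 (fun a b => 0 <= a /\ a <= b)) => [|a b a' b' [? ?] [? ?]|j _]; first lra.
    by split; [exact: Rmult_le_pos|exact: Rmult_le_compat].
  split; last exact: sum_inv_sqr.
  apply: sum_Rge0 => i _; apply/Rlt_le/Rinv_0_lt_compat/pow_lt.
  by have := pos_INR i; lra.
(* The sum over indices is compared with the sum over the cube by double counting: each code of the
   cube is hit by at most one index k. *)
apply: Rle_trans (_ : \big[Rplus/0]_(k < K) \big[Rplus/0]_b
   (if pickle_inv k == Some (g b) then box_weight (g b) else 0) <= _).
  apply: sum_Rle => k _; rewrite {1}/at_index.
  have p0 b : 0 <= if pickle_inv k == Some (g b) then box_weight (g b) else 0.
    by case: ifP => _; [apply: Rlt_le; exact: box_weight_pos|lra].
  case E : (@pickle_inv {ffun 'I_n -> nat} k) => [a|]; last by apply: sum_Rge0 => b _;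
    exact: Rle_refl.
  have ga : g [ffun j => inord (a j)] = a.
    by apply/ffunP => j; rewrite !ffunE inordK // ltnS; exact: (Hr k).
  have := sum_Rge_term _ _ [ffun j => inord (a j)] p0.
  by rewrite E ga eqxx.
rewrite exchange_big; apply: sum_Rle => b _ /=.
have H (k : nat) : pickle_inv k = Some (g b) -> k = pickle (g b).
  by move=> e; have := @pickle_invK {ffun 'I_n -> nat} k; rewrite e.
case: (ltnP (pickle (g b)) K) => h.
  rewrite (bigD1 (Ordinal h)) //= big1 => [|k kn].
    by rewrite Rplus_0_r; case: ifP => _; [lra|apply: Rlt_le; exact: box_weight_pos].
  case: eqP => // /H e; case/eqP: kn; exact: val_inj.
rewrite big1 => [|k _]; first by apply: Rlt_le; exact: box_weight_pos.
by case: eqP => // /H e; have := ltn_ord k; rewrite e ltnNge h.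
Qed.

Lemma Fourier_synthesis {n} (a : freq n -> C) :
  (forall N, exists K, forall xi, mu xi ^ N * Cmod (a xi) <= K) ->
  exists u, Cinfty_torus u /\ forall xi, hat u xi = a xi.
Proof.
move=> H.
pose b := at_index (RtoC 0) (fun al : {ffun 'I_n -> nat} => a (freq_of al)).
pose xs := at_index (fun _ : 'I_n => 0%Z) (@freq_of n).
have rb : rapid b xs.
  (* The extra 2 n powers of [mu] pay for the summable weight, by [box_weight_mu]. *)
  move=> N; have [K hK] := H (N + 2 * n)%N.
  apply: (ex_series_dominated _ (fun k => (4 ^ n * K) * at_index 0 (@box_weight n) k));
    last first.
    by apply: (ex_series_scal_l (V := R_NormedModule)); exact: box_weight_summable.
  move=> k; rewrite /b /xs /at_index; case: pickle_inv => [al|]; last first.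
    by rewrite Cmod_0 Rmult_0_l Rabs_R0 Rmult_0_r; exact: Rle_refl.
  have w0 := box_weight_pos al; have m0 := mu_pos (freq_of al).
  have a0 := Cmod_ge_0 (a (freq_of al)).
  have mN : 0 < mu (freq_of al) ^ N by exact: pow_lt.
  rewrite Rabs_pos_eq; last by apply: Rmult_le_pos => //; exact: Rlt_le.
  have h := box_weight_mu (freq_of al); rewrite freq_ofK in h.
  have hw : 1 <= (4 * mu (freq_of al) ^ 2) ^ n * box_weight al.
    by have := Rmult_le_compat_r _ _ _ (Rlt_le _ _ w0) h; rewrite Rinv_l; lra.
  have := hK (freq_of al).
  rewrite (_ : (N + 2 * n)%N = (N + 2 * n)%coq_nat) // pow_add pow_mult => hk.
  rewrite Rpow_mult_distr in hw.
  have q4 : 0 < 4 ^ n by apply: pow_lt; lra.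
  have e1 : Cmod (a (freq_of al)) * mu (freq_of al) ^ N
    <= Cmod (a (freq_of al)) * mu (freq_of al) ^ N * (4 ^ n * (mu (freq_of al) ^ 2) ^ n *
      box_weight al).
    rewrite -[X in X <= _]Rmult_1_r; apply: Rmult_le_compat_l => //.
    by apply: Rmult_le_pos => //; exact: Rlt_le.
  apply: Rle_trans e1 _.
  have p : 0 <= 4 ^ n * box_weight al by apply: Rmult_le_pos; exact: Rlt_le.
  have := Rmult_le_compat_r _ _ _ p hk; lra.
exists (fseries b xs); split; first exact: fseries_Cinfty.
move=> xi; set k0 := pickle (code xi).
have other k : k <> k0 -> Cmult (b k) (hat (char (xs k)) xi) = RtoC 0.
  move=> kn; rewrite /b /xs /at_index.
  case E : (@pickle_inv {ffun 'I_n -> nat} k) => [al|]; last by rewrite Cmult_0_l.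
  rewrite (hat_char_neq_freq (freq_of al)) ?Cmult_0_r // => e.
  apply: kn; have := @pickle_invK {ffun 'I_n -> nat} k; rewrite E /= => <-.
  by rewrite /k0 -e freq_ofK.
rewrite (hat_fseries_single _ _ xi k0 rb other).
by rewrite /b /xs /at_index pickleK_inv codeK hat_char Cmult_1_r.
Qed.

(** * Solvability from a lower bound on the discriminant *)

Lemma partial_lin {n} (j : 'I_n) (a : C) (u v : point n -> C) (x : point n) :
  ex_partial j u x -> ex_partial j v x ->
  ex_partial j (fun y => Cplus (Cmult a (u y)) (v y)) x /\
  partial j (fun y => Cplus (Cmult a (u y)) (v y)) x
  = Cplus (Cmult a (partial j u x)) (partial j v x).
Proof.
move=> [l hl] [m hm].
have lR := is_derive_Re _ _ _ hl; have lI := is_derive_Im _ _ _ hl.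
have mR := is_derive_Re _ _ _ hm; have mI := is_derive_Im _ _ _ hm.
have dR : is_derive (fun t => Re (Cplus (Cmult a (u (update x j t))) (v (update x j t)))) (x j)
    (Re (Cplus (Cmult a l) m)).
  apply: (is_derive_ext (fun t => (Re a * Re (u (update x j t)) - Im a * Im (u (update x j t)))
     + Re (v (update x j t)))) => //.
  apply: (is_derive_plus (V := R_NormedModule)) => //.
  by apply: (is_derive_minus (V := R_NormedModule)); exact: is_derive_scal.
have dI : is_derive (fun t => Im (Cplus (Cmult a (u (update x j t))) (v (update x j t)))) (x j)
    (Im (Cplus (Cmult a l) m)).
  apply: (is_derive_ext (fun t => (Re a * Im (u (update x j t)) + Im a * Re (u (update x j t)))
     + Im (v (update x j t)))) => //.
  apply: (is_derive_plus (V := R_NormedModule)) => //.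
  by apply: (is_derive_plus (V := R_NormedModule)); exact: is_derive_scal.
split; first by apply: ex_derive_C; eexists; eassumption.
have pl (w : point n -> C) k : is_derive (fun t => Re (w (update x j t))) (x j) (Re k) ->
    is_derive (fun t => Im (w (update x j t))) (x j) (Im k) -> partial j w x = k.
  by move=> h1 h2; rewrite /partial; apply: Ceq => /=; exact: is_derive_unique.
by rewrite (pl _ _ dR dI) (pl _ _ lR lI) (pl _ _ mR mI).
Qed.

(** The single form a u + v yields multiples, sums and differences, and is preserved by iterated
    derivatives. *)
Lemma Cinfty_lin {n} (a : C) (u v : point n -> C) : Cinfty_torus u -> Cinfty_torus v ->
  Cinfty_torus (fun y => Cplus (Cmult a (u y)) (v y)).
Proof.
move=> [pu su] [pv sv]; split; first by move=> x j; rewrite pu pv.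
have E s : iter_partial s (fun y => Cplus (Cmult a (u y)) (v y))
   = fun y => Cplus (Cmult a (iter_partial s u y)) (iter_partial s v y).
  elim: s => //= j s ->; apply: functional_extensionality => x.
  by have [_] := partial_lin j a _ _ x (proj2 (su s x) j) (proj2 (sv s x) j).
move=> s x; rewrite E; split; last first.
  by move=> j; have [] := partial_lin j a _ _ x (proj2 (su s x) j) (proj2 (sv s x) j).
apply/continuous_point => eps.
have a0 := Cmod_ge_0 a; have e0 := cond_pos eps.
have d1 : 0 < eps / (2 * (Cmod a + 1)) by apply: Rdiv_lt_0_compat; lra.
have d2 : 0 < eps / 2 by lra.
have [r Hr] := proj2 (continuous_point _ x) (proj1 (su s x)) (mkposreal _ d1).
have [r' Hr'] := proj2 (continuous_point _ x) (proj1 (sv s x)) (mkposreal _ d2).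
have r0 : 0 < Rmin r r' by apply: Rmin_pos; exact: cond_pos.
exists (mkposreal _ r0) => y /= hy.
have h1 := Hr y (fun j => Rlt_le_trans _ _ _ (hy j) (Rmin_l _ _)).
have h2 := Hr' y (fun j => Rlt_le_trans _ _ _ (hy j) (Rmin_r _ _)).
rewrite /= in h1 h2.
rewrite (_ : Cminus _ _ = Cplus (Cmult a (Cminus (iter_partial s u y) (iter_partial s u x)))
   (Cminus (iter_partial s v y) (iter_partial s v x))); last by ring.
apply: Rle_lt_trans (Cmod_triangle _ _) _; rewrite Cmod_mult.
have : Cmod a * Cmod (Cminus (iter_partial s u y) (iter_partial s u x))
   <= (Cmod a + 1) * (eps / (2 * (Cmod a + 1))).
  by apply: Rmult_le_compat; [lra|exact: Cmod_ge_0|lra|exact: Rlt_le].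
rewrite (_ : _ * (eps / _) = eps / 2); last by field; lra.
lra.
Qed.

Lemma Cinfty_char {n} (xi : freq n) : Cinfty_torus (char xi).
Proof.
pose a k : C := if k is 0%N then RtoC 1 else RtoC 0.
have ra : rapid a (fun _ => xi).
  move=> N; apply/(ex_series_incr_1 (V := R_NormedModule)).
  apply: (ex_series_ext (fun k => 0 * (1 / 2) ^ k)); first by move=> k;
    rewrite /= Cmod_0 !Rmult_0_l.
  apply: (ex_series_scal_l (V := R_NormedModule)); apply: ex_series_geom.
  by rewrite Rabs_pos_eq; lra.
rewrite (_ : char xi = fseries a (fun _ => xi)); first exact: fseries_Cinfty.
apply: functional_extensionality => x.
rewrite /fseries CSeries_incr_1; last exact: (rapid_summable a (fun _ => xi)).
by rewrite /= CSeries_Rscal; ring.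
Qed.

Lemma Cinfty_zero {n} : Cinfty_torus (fun _ : point n => RtoC 0).
Proof.
have := Cinfty_lin (RtoC (-1)) _ _ (Cinfty_char (fun _ : 'I_n => 0%Z)) (Cinfty_char (fun _ =>
  0%Z)).
rewrite (_ : (fun y => _) = fun _ => RtoC 0) //; apply: functional_extensionality => x.
by apply: Ceq => /=; ring.
Qed.

Lemma Cinfty_scal {n} (a : C) (u : point n -> C) : Cinfty_torus u ->
  Cinfty_torus (fun y => Cmult a (u y)).
Proof.
move=> cu; have := Cinfty_lin a _ _ cu Cinfty_zero.
by rewrite (_ : (fun y => Cplus _ _) = fun y => Cmult a (u y)) //;
  apply: functional_extensionality => x; rewrite Cplus_0_r.
Qed.

Lemma Cinfty_plus {n} (u v : point n -> C) : Cinfty_torus u -> Cinfty_torus v ->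
  Cinfty_torus (fun y => Cplus (u y) (v y)).
Proof.
move=> cu cv; have := Cinfty_lin (RtoC 1) _ _ cu cv.
by rewrite (_ : (fun y => Cplus _ _) = fun y => Cplus (u y) (v y)) //;
  apply: functional_extensionality => x; rewrite Cmult_1_l.
Qed.

Lemma Cinfty_sum {n} (I : Type) (r : seq I) (u : I -> point n -> C) :
  (forall i, Cinfty_torus (u i)) ->
  Cinfty_torus (fun x => \big[Cplus/RtoC 0]_(i <- r) u i x).
Proof.
move=> cu; elim: r => [|i r IH].
  rewrite (_ : (fun x => _) = fun _ => RtoC 0); first exact: Cinfty_zero.
  by apply: functional_extensionality => x; rewrite big_nil.
rewrite (_ : (fun x => _) = fun x => Cplus (u i x) (\big[Cplus/RtoC 0]_(i <- r) u i x));
  last first.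
  by apply: functional_extensionality => x; rewrite big_cons.
exact: Cinfty_plus.
Qed.

Lemma Cinfty_minus {n} (u v : point n -> C) : Cinfty_torus u -> Cinfty_torus v ->
  Cinfty_torus (fun y => Cminus (u y) (v y)).
Proof.
move=> cu cv; have := Cinfty_lin (RtoC (-1)) _ _ cv cu.
rewrite (_ : (fun y => Cplus _ _) = fun y => Cminus (u y) (v y)) //.
by apply: functional_extensionality => x; apply: Ceq => /=; ring.
Qed.

(** * The Euclidean norm against the weight [mu] *)

Lemma eucl_norm_coord {n} (xi : freq n) (j : 'I_n) : Rabs (IZR (xi j)) <= eucl_norm xi.
Proof.
rewrite -sqrt_Rsqr_abs; apply: sqrt_le_1_alt; rewrite Rsqr_pow2.
exact: (sum_Rge_term _ (fun j => IZR (xi j) ^ 2) j (fun j => pow2_ge_0 _)).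
Qed.

Lemma eucl_norm_mu {n} (xi : freq n) : eucl_norm xi <= mu xi.
Proof.
have m0 := mu_pos xi.
rewrite -(sqrt_pow2 (mu xi)); last lra.
apply: sqrt_le_1_alt.
have [s0 H] : 0 <= \big[Rplus/0]_(j < n) Rabs (IZR (xi j)) /\
    \big[Rplus/0]_(j < n) (IZR (xi j) ^ 2) <= (\big[Rplus/0]_(j < n) Rabs (IZR (xi j))) ^ 2.
  apply: (big_ind2 (fun b a => 0 <= b /\ a <= b ^ 2)) => [|a b a' b' [? ?] [? ?]|j _];
    first by lra.
    by split; nra.
  by rewrite pow2_abs; split; [exact: Rabs_pos|lra].
by apply: Rle_trans H _; apply: pow_incr; rewrite /mu; split => //;
  rewrite -[X in X <= _]Rplus_0_l; apply: Rplus_le_compat_r; lra.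
Qed.

Lemma mu_eucl_norm {n} (xi : freq n) : mu xi <= 1 + INR n * eucl_norm xi.
Proof.
apply: Rplus_le_compat_l; rewrite -[in INR n](card_ord n) -sum_Rconst.
by apply: sum_Rle => j _; exact: eucl_norm_coord.
Qed.

Lemma eucl_norm_opp {n} (xi : freq n) : eucl_norm (freq_opp xi) = eucl_norm xi.
Proof.
by rewrite /eucl_norm; congr sqrt; apply: eq_bigr => j _; rewrite /freq_opp opp_IZR /=; ring.
Qed.

Lemma vekua_disc_opp {n} (m : nat) (c : multi_index n -> C) (A B : C) (xi : freq n) :
  vekua_disc m c A B (freq_opp xi) = Cconj (vekua_disc m c A B xi).
Proof.
rewrite /vekua_disc freq_oppK; move: (symbol _ _ _) (symbol _ _ xi) => s t.
by apply: Ceq => /=; ring.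
Qed.

Lemma solvable_of_disc_bound {n} (m : nat) (c : multi_index n -> C) (A B : C) (gamma : R) :
  0 < gamma ->
  (forall xi : freq n, gamma <= eucl_norm xi ->
     Rpower (eucl_norm xi) (- gamma) <= Cmod (vekua_disc m c A B xi)) ->
  solvable (vekua m c A B).
Proof.
move=> g0 H.
exists (fun f => Cinfty_torus f /\ forall xi, eucl_norm xi < gamma -> hat f xi = RtoC 0).
split; last split.
- split.
  + by move=> f [].
  + by split; [exact: Cinfty_zero|move=> xi _; exact: hat_zero].
  + move=> f g [cf f0] [cg g0']; split; first exact: Cinfty_plus.
    by move=> xi hx; rewrite hat_plus ?f0 ?g0' ?Cplus_0_l //; exact: Cinfty_tame.
  + move=> a f [cf f0]; split; first exact: Cinfty_scal.
    by move=> xi hx; rewrite hat_scal ?f0 ?Cmult_0_r //; exact: Cinfty_tame.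
(* A frequency of norm below gamma has all codes at most 2 gamma, hence in the cube of side r.
   Subtracting the modes of [f] in the whole cube therefore removes all the low ones. *)
- have [r hr] := INR_unbounded (2 * gamma).
  pose al (b : {ffun 'I_n -> 'I_r.+1}) : {ffun 'I_n -> nat} := [ffun j => nat_of_ord (b j)].
  pose xs (i : 'I_#|{: {ffun 'I_n -> 'I_r.+1}}|) : freq n := freq_of (al (enum_val i)).
  exists #|{: {ffun 'I_n -> 'I_r.+1}}|, (fun i => char (xs i)).
  split; first by move=> i; exact: Cinfty_char.
  move=> f cf; exists (fun i => hat f (xs i)).
  have cs : Cinfty_torus (fun x => \big[Cplus/RtoC 0]_(i < #|{: {ffun 'I_n -> 'I_r.+1}}|)
      Cmult (hat f (xs i)) (char (xs i) x)).
    by apply: Cinfty_sum => i; apply: Cinfty_scal; exact: Cinfty_char.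
  split; first exact: Cinfty_minus.
  move=> xi hx.
  pose b : {ffun 'I_n -> 'I_r.+1} := [ffun j => inord (zenc (xi j))].
  have alb : al b = code xi.
    apply/ffunP => j; rewrite !ffunE inordK // ltnS.
    apply/leP/INR_le; apply: Rle_trans (zenc_bound _) _.
    by have := eucl_norm_coord xi j; lra.
  have xb : xs (enum_rank b) = xi by rewrite /xs enum_rankK alb codeK.
  rewrite hat_minus; try exact: Cinfty_tame.
  rewrite hat_sum; last by move=> i; apply: tame_scal; exact: char_tame.
  rewrite (bigD1 (enum_rank b)) //= big1 => [|i ib].
    by rewrite hat_scal ?xb ?hat_char; [ring|exact: char_tame].
  rewrite hat_scal ?hat_char_neq_freq ?Cmult_0_r //; last exact: char_tame.
  move=> e; case/eqP: ib; rewrite -(enum_valK i); congr enum_rank.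
  apply/ffunP => j; apply: val_inj.
  have := f_equal (fun q : {ffun 'I_n -> nat} => q j) (f_equal code e).
  by rewrite freq_ofK -alb !ffunE.
move=> f [cf f0].
pose D xi := vekua_disc m c A B xi.
pose num xi : C := ((Cconj (symbol m c (freq_opp xi)) - Cconj A) * hat f xi
   + B * Cconj (hat f (freq_opp xi)))%C.
(* Cramer's solution for hat u(xi). The cutoff depends on the norm only, so the two equations of a
   pair xi, -xi fall in the same case. *)
pose a xi : C := if Rlt_dec (eucl_norm xi) gamma then RtoC 0 else (num xi / D xi)%C.
have [S [S0 hS]] := symbol_bound m c.
have [G hG] := INR_unbounded gamma.
have Dlow xi : gamma <= eucl_norm xi -> D xi <> RtoC 0 /\ / Cmod (D xi) <= mu xi ^ G.
  move=> hx; have h := H xi hx; have n0 : 0 < eucl_norm xi by lra.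
  have p0 : 0 < Rpower (eucl_norm xi) (- gamma) by exact: exp_pos.
  have m1 := mu_ge1 xi.
  split; first by apply/Cmod_gt_0; exact: Rlt_le_trans h.
  apply: Rle_trans (Rinv_le_contravar _ _ p0 h) _.
  rewrite Rpower_Ropp Rinv_inv -Rpower_pow; last lra.
  apply: Rle_trans (_ : Rpower (mu xi) gamma <= _).
    by apply: Rle_Rpower_l; [lra|split=> //; exact: eucl_norm_mu].
  by apply: Rle_Rpower; lra.
have [u [cu hu]] : exists u, Cinfty_torus u /\ forall xi, hat u xi = a xi.
  apply: Fourier_synthesis => N.
  (* The exponent m absorbs the symbol in the numerator, G the inverse of the discriminant, and N is
     the decay to be reached. *)
  have [K hK] := Cinfty_hat_decay (m + G + N) f cf.
  set L := S + Cmod A + Cmod B.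
  have A0 := Cmod_ge_0 A; have B0 := Cmod_ge_0 B.
  have K0 : 0 <= K.
    apply: Rle_trans (hK (fun _ => 0%Z)); apply: Rmult_le_pos; last exact: Cmod_ge_0.
    by apply/Rlt_le/pow_lt; exact: mu_pos.
  exists (L * (2 * K)) => xi; rewrite /a; case: Rlt_dec => [?|nx].
    by rewrite Cmod_0 Rmult_0_r; apply: Rmult_le_pos; rewrite /L; lra.
  have hx := Rnot_lt_le _ _ nx.
  have [D0 Dm] := Dlow xi hx.
  have hm : 1 <= mu xi ^ m by apply: pow_R1_Rle; exact: mu_ge1.
  have mN : 0 < mu xi ^ N by apply: pow_lt; exact: mu_pos.
  have mG : 0 < mu xi ^ G by apply: pow_lt; exact: mu_pos.
  have mm : 0 < mu xi ^ m by lra.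
  set F := Cmod (hat f xi); set F' := Cmod (hat f (freq_opp xi)).
  have F0 : 0 <= F by exact: Cmod_ge_0.
  have F0' : 0 <= F' by exact: Cmod_ge_0.
  have hn : Cmod (num xi) <= L * mu xi ^ m * (F + F').
    apply: Rle_trans (Cmod_triangle _ _) _; rewrite !Cmod_mult Cmod_conj -/F -/F'.
    have hs : Cmod (Cconj (symbol m c (freq_opp xi)) - Cconj A) <= L * mu xi ^ m.
      apply: Rle_trans (Cmod_triangle _ _) _; rewrite Cmod_opp !Cmod_conj.
      have := hS (freq_opp xi); rewrite mu_opp /L; nra.
    have hB : Cmod B <= L * mu xi ^ m by rewrite /L; nra.
    have := Rmult_le_compat_r _ _ _ F0 hs; have := Rmult_le_compat_r _ _ _ F0' hB; lra.
  rewrite Cmod_div //.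
  have e : mu xi ^ (m + G + N) = mu xi ^ m * mu xi ^ G * mu xi ^ N by rewrite !pow_add.
  have h1 := hK xi; have h2 := hK (freq_opp xi).
  rewrite mu_opp e -/F -/F' in h1 h2.
  have : Cmod (num xi) / Cmod (D xi) <= L * mu xi ^ m * (F + F') * mu xi ^ G.
    apply: Rmult_le_compat => //; first exact: Cmod_ge_0.
    by apply/Rlt_le/Rinv_0_lt_compat/Cmod_gt_0.
  move=> /(Rmult_le_compat_l _ _ _ (Rlt_le _ _ mN)) h3; apply: Rle_trans h3 _.
  have L0 : 0 <= L by rewrite /L; lra.
  rewrite (_ : _ * _ = L * (mu xi ^ m * mu xi ^ G * mu xi ^ N * F + mu xi ^ m * mu xi ^ G * mu
    xi ^ N * F')); last by ring.
  by apply: Rmult_le_compat_l; lra.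
exists u; split=> // x.
have tf := Cinfty_tame f cf; have tv := vekua_tame m c A B u cu.
suff z : Cminus (vekua m c A B u x) (f x) = RtoC 0.
  by rewrite (_ : vekua m c A B u x = Cplus (Cminus (vekua m c A B u x) (f x)) (f x));
    [rewrite z; ring|ring].
apply: (hat_uniqueness (fun x => Cminus (vekua m c A B u x) (f x))); first exact: tame_minus.
move=> xi; rewrite hat_minus // hat_vekua // !hu /a eucl_norm_opp.
case: Rlt_dec => [hx|nx].
  by rewrite f0 //; apply: Ceq => /=; ring.
have hx := Rnot_lt_le _ _ nx.
have [D0 _] := Dlow xi hx.
have eB : Cmult B (Cconj B) = RtoC (Cmod B ^ 2) by rewrite Cmod2_conj.
have eD : D (freq_opp xi) = Cconj (D xi) by exact: vekua_disc_opp.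
(* The conjugate of the value prescribed at -xi is the second unknown of the system at xi, with the
   same determinant by [vekua_disc_opp]. *)
have cD : Cconj (num (freq_opp xi) / D (freq_opp xi))%C
  = (((symbol m c xi - A) * Cconj (hat f (freq_opp xi)) + Cconj B * hat f xi) / D xi)%C.
  rewrite eD /num freq_oppK.
  have conj_mult z w : Cconj (Cmult z w) = Cmult (Cconj z) (Cconj w) by apply: Ceq;
    rewrite /Re /Im /=; ring.
  have conj_plus z w : Cconj (Cplus z w) = Cplus (Cconj z) (Cconj w) by apply: Ceq;
    rewrite /Re /Im /=; ring.
  have conjK z : Cconj (Cconj z) = z by apply: Ceq; rewrite /Re /Im /=; ring.
  rewrite /Cdiv conj_mult conj_plus !conj_mult !conjK.
  congr (Cmult (Cplus (Cmult _ _) _) _); first by apply: Ceq; rewrite /Re /Im /=; ring.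
  have i0 : Cconj (D xi) <> RtoC 0.
    by move=> /(f_equal Cconj); rewrite conjK => e; apply: D0; rewrite e; apply: Ceq;
      rewrite /Re /Im /=; ring.
  have h : Cmult (Cconj (Cinv (Cconj (D xi)))) (D xi) = RtoC 1.
    rewrite -{2}(conjK (D xi)) -conj_mult Cinv_l //; apply: Ceq; rewrite /Re /Im /=; ring.
  rewrite -[LHS]Cmult_1_r -(Cinv_r (D xi)) // Cmult_assoc h; ring.
rewrite cD /num.
move: (D0); rewrite /D /vekua_disc -eB.
move: (symbol m c xi) (Cconj (symbol m c (freq_opp xi))) (Cconj (hat f (freq_opp xi))) (hat f
  xi) (Cconj B) (Cconj A).
move=> s t p q B' A' nz /=; field; exact: nz.
Qed.

(** * Obstruction from small discriminants *)

(** Gaussian elimination of the last coordinate: multiples of a pivot vector [p] are subtracted from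
    the others, a dependence of these is found in one dimension less, and [d] is the coefficient
    then owed to the pivot. *)
Lemma linear_dependence (k : nat) (v : 'I_k.+1 -> 'I_k -> C) :
  exists c : 'I_k.+1 -> C, (exists i, c i <> RtoC 0) /\
    forall j, \big[Cplus/RtoC 0]_i Cmult (c i) (v i j) = RtoC 0.
Proof.
elim: k v => [|k IH] v.
  exists (fun _ => RtoC 1); split; last by case.
  by exists ord0; exact: C1_nz.
have [p [r hr]] : exists (p : 'I_k.+2) (r : 'I_k.+1 -> C), forall i,
    v (lift p i) ord_max = Cmult (r i) (v p ord_max).
  have [[p hp]|none] := classic (exists p, v p ord_max <> RtoC 0).
    by exists p, (fun i => Cdiv (v (lift p i) ord_max) (v p ord_max)) => i; field.
  (* Without a pivot every last coordinate is 0, and zero multipliers do. *)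
  exists ord0, (fun _ => RtoC 0) => i; rewrite Cmult_0_l; apply: NNPP => h.
  by apply: none; eexists; exact: h.
have [c [[i ci] hc]] := IH (fun i j => Cminus (v (lift p i) (lift ord_max j))
   (Cmult (r i) (v p (lift ord_max j)))).
pose d := Copp (\big[Cplus/RtoC 0]_i Cmult (c i) (r i)).
exists (fun l => if unlift p l is Some l' then c l' else d); split.
  by exists (lift p i); rewrite liftK.
move=> j; rewrite (bigD1_ord p) //= unlift_none.
under eq_bigr => l _ do rewrite liftK.
rewrite /d (_ : Cmult (Copp _) _
  = Cmult (Copp (v p j)) (\big[Cplus/RtoC 0]_i Cmult (c i) (r i))); last by ring.
rewrite sum_Cmult -big_split /=.
case: (unliftP ord_max j) => [j' ->|->].
  apply: etrans (hc j'); apply: eq_bigr => l _; ring.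
by apply: big1 => l _; rewrite hr; ring.
Qed.

Lemma frequencies_of_small_disc {n} (m : nat) (c : multi_index n -> C) (A B : C) :
  ~ (exists gamma : R, 0 < gamma /\ forall xi : freq n, gamma <= eucl_norm xi ->
       Rpower (eucl_norm xi) (- gamma) <= Cmod (vekua_disc m c A B xi)) ->
  forall N : nat, exists xi : freq n,
    INR N <= mu xi /\ Cmod (vekua_disc m c A B xi) * mu xi ^ N <= 1.
Proof.
move=> H N; apply: NNPP => none; apply: H.
(* For r >= G one has mu <= 1 + n r <= r^2, so mu^N <= r^(2N) <= r^G, and also mu >= r >= N. *)
pose G := (2 * N + n + 1)%N.
have GE : INR G = 2 * INR N + INR n + 1 by rewrite /G mul2n -addnn !plus_INR [INR 1]/=; lra.
have N0 := pos_INR N; have n0 := pos_INR n.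
exists (INR G); split; first by lra.
move=> xi hx; apply: Rnot_lt_le => small; apply: none; exists xi.
set r := eucl_norm xi in hx small; have r1 : 1 <= r by lra.
have m0 := mu_pos xi.
split; first by have := eucl_norm_mu xi; rewrite -/r; lra.
have mr : mu xi <= r ^ 2.
  have := mu_eucl_norm xi; rewrite -/r; nra.
have mN : mu xi ^ N <= r ^ (2 * N).
  by rewrite pow_mult; apply: pow_incr; split => //; exact: Rlt_le.
rewrite Rpower_Ropp Rpower_pow in small; last lra.
have rG : 0 < r ^ G by apply: pow_lt; lra.
apply: Rle_trans (_ : / r ^ G * r ^ (2 * N) <= _).
  apply: Rmult_le_compat => //; [exact: Cmod_ge_0| |exact: Rlt_le].
  by apply/Rlt_le/pow_lt.
have le : r ^ (2 * N) <= r ^ G by apply: Rle_pow => //; apply/leP; rewrite /G -addnA leq_addr.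
have := Rmult_le_compat_l _ _ _ (Rlt_le _ _ (Rinv_0_lt_compat _ rG)) le.
by rewrite Rinv_l; lra.
Qed.

(* If the datum has no (-xi)-mode, Cramer's rule for the 2x2 system of the
   modes of u at xi and -xi bounds its xi-mode by |Delta_xi|; for B = 0 the
   system is diagonal and Delta_xi is the product of the two diagonal entries,
   so that one of them is small at xi or at -xi. *)
Lemma small_mode_control {n} (m : nat) (c : multi_index n -> C) (A B : C) :
  (forall N : nat, exists xi : freq n,
    INR N <= mu xi /\ Cmod (vekua_disc m c A B xi) * mu xi ^ N <= 1) ->
  exists (tau : freq n -> R) (beta : R), [/\ 0 < beta, forall xi, 0 <= tau xi,
    forall N : nat, exists xi, INR N <= mu xi /\ tau xi * mu xi ^ N <= 1 &
    forall u xi M, Cinfty_torus u -> (forall eta, Cmod (hat u eta) <= M) ->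
      hat (vekua m c A B u) (freq_opp xi) = RtoC 0 ->
      beta * Cmod (hat (vekua m c A B u) xi) <= tau xi * M].
Proof.
move=> H; have conj_mult z w : Cconj (Cmult z w) = Cmult (Cconj z) (Cconj w).
  by apply: Ceq; rewrite /Re /Im /=; ring.
have conj_minus z w : Cconj (Cminus z w) = Cminus (Cconj z) (Cconj w).
  by apply: Ceq; rewrite /Re /Im /=; ring.
have [B0|B0] := Req_dec (Cmod B) 0.
  have Bz : B = RtoC 0 by exact: Cmod_eq_0.
  exists (fun xi => Cmod (Cminus (symbol m c xi) A)), 1; split.
  - exact: Rlt_0_1.
  - by move=> xi; exact: Cmod_ge_0.
  (* A product of two factors weighted by mu^(2N) is at most 1, so one of the factors weighted by
     mu^N is at most 1. *)
  - move=> N; have [xi [hN]] := H (2 * N)%N.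
    have pN : 0 < mu xi ^ N by apply: pow_lt; exact: mu_pos.
    rewrite /vekua_disc B0 (_ : Cminus (Cmult _ _) _ = Cmult (Cminus (symbol m c xi) A)
       (Cconj (Cminus (symbol m c (freq_opp xi)) A))); last first.
      by rewrite conj_minus /= Rmult_0_l; ring.
    rewrite Cmod_mult Cmod_conj (_ : (2 * N)%N = (N + N)%coq_nat); last by rewrite mulSn mul1n.
    rewrite pow_add.
    set d := Cmod _; set d' := Cmod _ => hd.
    have lN : INR N <= mu xi.
      by apply: Rle_trans hN; apply: le_INR; apply/leP; rewrite mulSn leq_addr.
    have d0 : 0 <= d by exact: Cmod_ge_0.
    have d0' : 0 <= d' by exact: Cmod_ge_0.
    case: (Rle_dec (d * mu xi ^ N) 1) => h; first by exists xi.
    exists (freq_opp xi); rewrite mu_opp; split=> //; rewrite -/d'; nra.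
  - move=> u xi M cu uM _; rewrite hat_vekua // Bz Rmult_1_l.
    rewrite (_ : Cminus _ _ = Cmult (Cminus (symbol m c xi) A) (hat u xi)); last by ring.
    by rewrite Cmod_mult; apply: Rmult_le_compat_l => //; exact: Cmod_ge_0.
exists (fun xi => Cmod (vekua_disc m c A B xi)), (Cmod B); split => //.
- by have := Cmod_ge_0 B; lra.
- by move=> xi; exact: Cmod_ge_0.
move=> u xi M cu uM; rewrite !hat_vekua // freq_oppK => h0.
set F := Cminus _ _.
(* Conjugating the vanishing (-xi)-mode expresses conj(B) hat u(xi) through conj(hat u(-xi));
   inserted into conj(B) F, it leaves exactly the discriminant as coefficient. *)
have : Cmult (Cconj B) F = Cmult (vekua_disc m c A B xi) (Cconj (hat u (freq_opp xi))).
  move/(f_equal Cconj): h0; rewrite conj_minus !conj_mult conj_minus.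
  have -> : Cconj (Cconj (hat u xi)) = hat u xi by apply: Ceq; rewrite /Re /Im /=; ring.
  have -> : Cconj (RtoC 0) = RtoC 0 by apply: Ceq; rewrite /Re /Im /=; ring.
  rewrite /F /vekua_disc Cmod2_conj.
  move: (Cconj (hat u (freq_opp xi))) (Cconj (symbol m c (freq_opp xi))) => b t.
  move: (Cconj B) (Cconj A) (hat u xi) (symbol m c xi) => B' A' a s e.
  have e' : Cmult B' a = Cmult (Cminus t A') b.
    by rewrite (_ : Cmult B' a = Cminus (Cmult (Cminus t A') b) (Cminus (Cmult (Cminus t A') b)
      (Cmult B' a))); [rewrite e; ring|ring].
  rewrite (_ : Cmult B' _ = Cminus (Cmult (Cminus s A) (Cmult B' a)) (Cmult (Cmult B B') b));
    last by ring.
  by rewrite e'; ring.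
move/(f_equal Cmod); rewrite !Cmod_mult !Cmod_conj => ->.
by apply: Rmult_le_compat_l => //; exact: Cmod_ge_0.
Qed.

Lemma subspace_lincomb {n} (F : (point n -> C) -> Prop) (I : Type) (r : seq I)
  (c : I -> C) (f : I -> point n -> C) : Cinfty_subspace F -> (forall i, F (f i)) ->
  F (fun x => \big[Cplus/RtoC 0]_(i <- r) Cmult (c i) (f i x)).
Proof.
move=> SF Ff; elim: r => [|i r IH].
  rewrite (_ : (fun x => _) = fun _ => RtoC 0); first exact: subspace_zero.
  by apply: functional_extensionality => x; rewrite big_nil.
rewrite (_ : (fun x => _) = fun x => Cplus (Cmult (c i) (f i x))
   (\big[Cplus/RtoC 0]_(i <- r) Cmult (c i) (f i x))).
  by apply: (subspace_add SF) => //; exact: (subspace_scal SF).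
by apply: functional_extensionality => x; rewrite big_cons.
Qed.

(** A dependence among the k + 1 coordinate vectors relative to the k spanning classes makes the
    [g j] cancel and leaves a combination of the [f i] in [F]. *)
Lemma finite_codim_lincomb {n} (F : (point n -> C) -> Prop) :
  Cinfty_subspace F -> finite_codim F ->
  exists k : nat, forall f : 'I_k.+1 -> point n -> C, (forall i, Cinfty_torus (f i)) ->
    exists c : 'I_k.+1 -> C, (exists i, c i <> RtoC 0) /\
      F (fun x => \big[Cplus/RtoC 0]_i Cmult (c i) (f i x)).
Proof.
move=> SF [k [g [cg Hg]]]; exists k => f cf.
have [a Ha] := fin_all_exists (fun i => Hg (f i) (cf i)).
have [c [cn hc]] := linear_dependence k a.
exists c; split=> //.
have := subspace_lincomb _ _ (index_enum 'I_k.+1) c _ SF Ha.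
rewrite (_ : (fun x => _) = fun x => \big[Cplus/RtoC 0]_i Cmult (c i) (f i x)) //.
apply: functional_extensionality => x.
rewrite (eq_bigr (fun i => Cplus (Cmult (c i) (f i x))
   (\big[Cplus/RtoC 0]_j Cmult (Copp (g j x)) (Cmult (c i) (a i j))))); last first.
  move=> i _; rewrite /Cminus Cmult_plus_distr_l; congr Cplus.
  have e z : Cmult (c i) (Copp z) = Cmult (Copp (c i)) z by ring.
  by rewrite e sum_Cmult; apply: eq_bigr => j _; ring.
rewrite big_split exchange_big /= [X in Cplus _ X]big1 ?Cplus_0_r // => j _.
by rewrite -sum_Cmult hc Cmult_0_r.
Qed.

Lemma sparse_frequencies {n} (tau : freq n -> R) : (forall xi, 0 <= tau xi) ->
  (forall N : nat, exists xi, INR N <= mu xi /\ tau xi * mu xi ^ N <= 1) ->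
  exists xs : nat -> freq n, forall k,
    [/\ INR k + 2 <= mu (xs k), tau (xs k) * mu (xs k) ^ k.+1 <= 1 &
        mu (xs k) < mu (xs k.+1)].
Proof.
move=> t0 H.
have step (p : nat * freq n) : exists xi, [/\ INR p.1 + 2 <= mu xi,
    tau xi * mu xi ^ p.1.+1 <= 1 & mu p.2 < mu xi].
  have [q hq] := INR_unbounded (mu p.2).
  (* The summand q forces growth beyond the previous frequency, and 2 keeps away from the zero
     frequency, where [mu] is 1; the exponent is then lowered to the one required. *)
  have [xi [h1 h2]] := H (p.1 + 2 + q)%N; exists xi.
  rewrite !plus_INR /= in h1; have := pos_INR q; have := pos_INR p.1 => ? ?.
  split; [lra| |lra].
  apply: Rle_trans h2; apply: Rmult_le_compat_l => //; apply: mu_pow_mono.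
  by rewrite addn2; exact: leq_trans (leqnSn _) (leq_addr _ _).
have [nxt hn] := functional_choice _ step.
pose xs := fix xs k := nxt (k, if k is k'.+1 then xs k' else fun _ => 0%Z).
exists xs => k.
have e l : xs l = nxt (l, if l is l'.+1 then xs l' else fun _ => 0%Z) by case: l.
split; first by rewrite e; case: (hn (k, if k is l'.+1 then xs l' else fun _ => 0%Z)).
  by rewrite e; case: (hn (k, if k is l'.+1 then xs l' else fun _ => 0%Z)).
by rewrite [in X in _ < X]e; case: (hn (k.+1, xs k)).
Qed.

Lemma not_solvable_of_small_modes {n} (m : nat) (c : multi_index n -> C) (A B : C)
  (tau : freq n -> R) (beta : R) : 0 < beta -> (forall xi, 0 <= tau xi) ->
  (forall N : nat, exists xi, INR N <= mu xi /\ tau xi * mu xi ^ N <= 1) ->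
  (forall u xi M, Cinfty_torus u -> (forall eta, Cmod (hat u eta) <= M) ->
      hat (vekua m c A B u) (freq_opp xi) = RtoC 0 ->
      beta * Cmod (hat (vekua m c A B u) xi) <= tau xi * M) ->
  ~ solvable (vekua m c A B).
Proof.
move=> b0 t0 H ctrl [F [SF [cF sF]]].
have [xs hxs] := sparse_frequencies tau t0 H.
have mono k l : (k < l)%N -> mu (xs k) < mu (xs l).
  elim: l => // l IH; rewrite ltnS leq_eqVlt => /orP[/eqP ->|kl].
    by have [_ _] := hxs l.
  by apply: Rlt_trans (IH kl) _; have [_ _] := hxs l.
have inj k l : mu (xs k) = mu (xs l) -> k = l.
  by move=> e; case: (ltngtP k l) => // /mono; rewrite e; lra.
have m2 k : 2 <= mu (xs k) by have [h _ _] := hxs k; have := pos_INR k; lra.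
(* As [mu] is even and injective along the sequence, equality would give k = l, hence the zero
   frequency, against [mu] at least 2. *)
have opp k l : xs k <> freq_opp (xs l).
  move=> e; have kl : k = l by apply: inj; rewrite e mu_opp.
  have := m2 l; rewrite /mu big1; first lra.
  move=> j _; have := f_equal (fun xi : freq n => xi j) e; rewrite kl /freq_opp => ej.
  have -> : xs l j = 0%Z by lia.
  exact: Rabs_R0.
(* The growing exponent gives rapid decay, yet the weight still exceeds [tau] by a factor [mu],
   since tau * mu^(k+1) <= 1. *)
pose w k := / mu (xs k) ^ k.
have w0 k : 0 < w k by apply/Rinv_0_lt_compat/pow_lt; exact: mu_pos.
have [k Hk] := finite_codim_lincomb F SF cF.
(* The data have disjoint spectra, so no combination cancels: wherever the coefficient of the i-th
   one is nonzero, its whole residue class survives. *)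
pose a (i : 'I_k.+1) t : C := if (t %% k.+1 == i)%N then RtoC (w t) else RtoC 0.
have ra i : rapid (a i) xs.
  move=> N; apply: (ex_series_dominated _ (fun t => w t * mu (xs t) ^ N)).
    move=> t; have mN : 0 < mu (xs t) ^ N by apply: pow_lt; exact: mu_pos.
    rewrite Rabs_mult (Rabs_pos_eq (_ ^ _)); last exact: Rlt_le.
    apply: Rmult_le_compat_r; first exact: Rlt_le.
    rewrite /a; case: ifP => _; rewrite ?Cmod_0 ?Cmod_R ?Rabs_Rabsolu ?Rabs_R0;
      last exact: Rlt_le.
    by rewrite Rabs_pos_eq; [exact: Rle_refl|exact: Rlt_le].
  (* After dropping N terms, mu^(-N-t) mu^N = mu^(-t) <= 2^(-t). *)
  apply/(ex_series_incr_n (V := R_NormedModule) _ N).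
  apply: (ex_series_dominated _ (fun t => (1 / 2) ^ t)); last first.
    by apply: ex_series_geom; rewrite Rabs_pos_eq; lra.
  move=> t; rewrite /w; set y := mu _; have y2 : 2 <= y by exact: m2.
  have yN : 0 < y ^ N by apply: pow_lt; lra.
  have yt : 0 < y ^ t by apply: pow_lt; lra.
  have -> : / y ^ (N + t)%coq_nat * y ^ N = (/ y) ^ t.
    by rewrite pow_add pow_inv; field; lra.
  rewrite -RPow_abs; apply: pow_incr; split; first exact: Rabs_pos.
  rewrite Rabs_pos_eq; last by apply/Rlt_le/Rinv_0_lt_compat; lra.
  by have := Rinv_le_contravar 2 y ltac:(lra) y2; lra.
have [d [[i di] Fd]] := Hk (fun i => fseries (a i) xs) (fun i => fseries_Cinfty _ _ (ra i)).
have [u [cu hu]] := sF _ Fd.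
have tfs j : tame (fseries (a j) xs) by apply: Cinfty_tame; exact: fseries_Cinfty.
have hatf eta : hat (vekua m c A B u) eta
   = \big[Cplus/RtoC 0]_j Cmult (d j) (hat (fseries (a j) xs) eta).
  rewrite (functional_extensionality _ _ hu) hat_sum.
    by apply: eq_bigr => j _; rewrite hat_scal.
  by move=> j; exact: tame_scal.
have off t : hat (vekua m c A B u) (freq_opp (xs t)) = RtoC 0.
  rewrite hatf big1 // => j _.
  rewrite (hat_fseries _ _ _ 0) //; first by rewrite big_ord0 Cmult_0_r.
  by move=> l _; rewrite hat_char_neq_freq ?Cmult_0_r //; exact: opp.
have at_t t : (t %% k.+1)%N = i -> hat (vekua m c A B u) (xs t) = Cmult (d i) (RtoC (w t)).
  move=> ti; rewrite hatf.
  have hj j : hat (fseries (a j) xs) (xs t) = a j t.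
    rewrite (hat_fseries_single _ _ _ t) //; first by rewrite hat_char Cmult_1_r.
    move=> l lt; rewrite hat_char_neq_freq ?Cmult_0_r // => e; apply: lt; apply: inj.
    by rewrite e.
  rewrite (bigD1 i) //= big1 => [|j ji]; first by rewrite hj /a ti eqxx Cplus_0_r.
  rewrite hj /a ti; case: eqP => [e|_]; last by rewrite Cmult_0_r.
  by case/eqP: ji; apply: val_inj; rewrite /= e.
have [M0 hM0] := Cinfty_bounded u cu.
pose M := 2 ^ n * M0.
have hM eta : Cmod (hat u eta) <= M by apply: hat_bound => //; exact: Cinfty_tame.
have Mge0 : 0 <= M by apply: Rle_trans (hM (fun _ => 0%Z)); exact: Cmod_ge_0.
have d0 : 0 < Cmod (d i) by exact/Cmod_gt_0.
have bd : 0 < beta * Cmod (d i) by exact: Rmult_lt_0_compat.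
have [s hs] := INR_unbounded (M / (beta * Cmod (d i))).
(* An index in the i-th class with t >= s, so that mu(xs t) >= t + 2 > s exceeds M / (beta |d
   i|). *)
pose t := (s * k.+1 + i)%N.
have ti : (t %% k.+1)%N = i by rewrite /t modnMDl modn_small.
have := ctrl u (xs t) M cu hM (off t).
rewrite at_t // Cmod_mult Cmod_R Rabs_pos_eq; last exact: Rlt_le.
have [h1 h2 _] := hxs t; have wt := w0 t; have mt := mu_pos (xs t).
have mtt : 0 < mu (xs t) ^ t by exact: pow_lt.
have tw : tau (xs t) * mu (xs t) <= w t.
  have := Rmult_le_compat_r _ _ _ (Rlt_le _ _ wt) h2.
  rewrite /w /= Rmult_1_l => h3; apply: Rle_trans h3; apply: Req_le; field; lra.
have st : INR s <= INR t by apply: le_INR; apply/leP; rewrite /t mulnS -addnA leq_addr.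
move=> h3.
(* The control inequality times [mu]; dividing by the positive w t would bound mu(xs t) by M / (beta
   |d i|), contrary to the choice of t. *)
have : beta * Cmod (d i) * w t * mu (xs t) <= w t * M.
  have e1 := Rmult_le_compat_r _ _ _ (Rlt_le _ _ mt) h3.
  have e2 := Rmult_le_compat_r _ _ _ Mge0 tw; lra.
have hs' : M < INR s * (beta * Cmod (d i)) by apply/Rlt_div_l.
have : M * w t < beta * Cmod (d i) * w t * mu (xs t).
  apply: Rlt_le_trans (_ : INR s * (beta * Cmod (d i)) * w t <= _).
    exact: Rmult_lt_compat_r.
  rewrite (_ : _ * mu _ = mu (xs t) * (beta * Cmod (d i)) * w t); last by ring.
  apply: Rmult_le_compat_r; first exact: Rlt_le.
  by apply: Rmult_le_compat_r; lra.
lra.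
Qed.

Theorem theorem2 (n m : nat) (hn : (1 <= n)%N)
    (c : multi_index n -> C) (A B : C) :
  solvable (vekua m c A B) <->
  (exists gamma : R,
     0 < gamma /\
     forall xi : freq n,
       gamma <= eucl_norm xi ->
       Rpower (eucl_norm xi) (- gamma) <= Cmod (vekua_disc m c A B xi)).
Proof.
split=> [sol|[gamma [g0 H]]]; last exact: solvable_of_disc_bound H.
apply: NNPP => /frequencies_of_small_disc /small_mode_control [tau [beta [b0 t0 H ctrl]]].
exact: (not_solvable_of_small_modes m c A B tau beta b0 t0 H ctrl).
Qed.
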